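(* Let $K$ be a compact space in the class (MS). Then for any isomorphic embedding $T\colon c_0\to C(K)$, the space $T[c_0]$ contains a subspace $Y$ which is isomorphic to $c_0$ and complemented in $C(K)$.
   Context: Compact spaces are Hausdorff, and $C(K)$ is the Banach space of real-valued continuous functions on $K$ with the supremum norm. A compact space $K$ is in the class (MS) if every probability Radon measure $\mu$ on $K$ has countable Maharam type, i.e. $L_1(\mu)$ is a separable Banach space. An isomorphic embedding is a bounded linear operator that is an isomorphism onto its (closed) range. A closed subspace is complemented in a Banach space if it is the range of a bounded linear projection on that space. *)

(* Defs.v *)
From HB Require Import structures.
From mathcomp Require Import all_boot all_order all_algebra.
From mathcomp Require Import all_classical all_reals all_analysis.

Set Implicit Arguments.
Unset Strict Implicit.
Unset Printing Implicit Defensive.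

Import Order.TTheory GRing.Theory Num.Theory.
Import numFieldNormedType.Exports.

Local Open Scope classical_set_scope.
Local Open Scope ring_scope.

HB.mixin Record isCompactHausdorff T & Topological T := {
  compact_setT : compact [set: T] ;
  hausdorff_setT : hausdorff_space T
}.

#[short(type="compactHausdorffType")]
HB.structure Definition CompactHausdorff :=
  {T of Topological T & isCompactHausdorff T}.

Section supnorm.
Context (R : realType) (I : Type).
Implicit Types f g : I -> R.

(* sup set0 = 0, so the only function on an empty I has norm 0. *)
Definition supnorm f : R := sup [set `|f i| | i in [set: I]].

Definition bounded_values f := has_ubound [set `|f i| | i in [set: I]].

Lemma le_supnorm f i : bounded_values f -> `|f i| <= supnorm f.
Proof. by move=> bf; apply: ub_le_sup => //; exists i. Qed.

Lemma supnorm_le f (M : R) : 0 <= M -> (forall i, `|f i| <= M) -> supnorm f <= M.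
Proof.
move=> M0 fM; have [[i _]|noI] := pselect (exists i : I, True).
  by apply: ge_sup; [exists `|f i|, i|move=> ? [j _ <-]].
rewrite /supnorm (_ : [set _ | _ in _] = set0) ?sup0 //.
by apply/seteqP; split=> // ? [i _ _]; case: noI; exists i.
Qed.

Lemma supnorm_ge0 f : bounded_values f -> 0 <= supnorm f.
Proof.
move=> bf; have [[i _]|noI] := pselect (exists i : I, True).
  exact: le_trans (normr_ge0 (f i)) (le_supnorm i bf).
rewrite /supnorm (_ : [set _ | _ in _] = set0) ?sup0 //.
by apply/seteqP; split=> // ? [i _ _]; case: noI; exists i.
Qed.

Lemma supnormD f g : bounded_values f -> bounded_values g ->
  supnorm (f \+ g) <= supnorm f + supnorm g.
Proof.
move=> bf bg; apply: supnorm_le => [|i]; first by rewrite addr_ge0 ?supnorm_ge0.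
by rewrite (le_trans (ler_normD _ _))// lerD ?le_supnorm //.
Qed.

Lemma supnormZ (a : R) f : bounded_values f -> bounded_values (a \*: f) ->
  supnorm (a \*: f) = `|a| * supnorm f.
Proof.
move=> bf baf; apply/eqP; rewrite eq_le; apply/andP; split.
  apply: supnorm_le => [|i]; first by rewrite mulr_ge0 ?supnorm_ge0.
  by rewrite [leLHS](normrM a (f i)) ler_wpM2l ?le_supnorm.
have [a0|a0] := eqVneq a 0.
  by rewrite [in leLHS]a0 normr0 mul0r supnorm_ge0.
rewrite mulrC -ler_pdivlMr ?normr_gt0//; apply: supnorm_le => [|i].
  by rewrite divr_ge0 ?supnorm_ge0.
rewrite ler_pdivlMr ?normr_gt0// mulrC -normrM.
exact: (le_supnorm i baf).
Qed.

Lemma supnorm0_eq0 f : bounded_values f -> supnorm f = 0 -> f =1 (fun=> 0).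
Proof.
by move=> bf f0 i; apply/eqP; rewrite -normr_le0 -f0 le_supnorm //.
Qed.

End supnorm.

Section continuous_functions.
Context (K : compactHausdorffType) (R : realType).

Definition Ccarrier : {pred K -> R} := mem [set f : K -> R | continuous f].

Lemma Ccarrier_submod_closed : submod_closed Ccarrier.
Proof.
split=> [|a f g /set_mem cf /set_mem cg]; apply/mem_set => x.
  exact: cvg_cst.
by apply: cvgD; [apply: cvgZr; exact: cf | exact: cg].
Qed.

HB.instance Definition _ :=
  GRing.isSubmodClosed.Build R (K -> R) Ccarrier Ccarrier_submod_closed.

Record Cspace := MkCspace {
  Cspace_fun :> K -> R ;
  Cspace_funP : Cspace_fun \in Ccarrier
}.

HB.instance Definition _ := [isSub for Cspace_fun].
HB.instance Definition _ := [Choice of Cspace by <:].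
HB.instance Definition _ := [SubChoice_isSubLmodule of Cspace by <:].

Lemma Cspace_continuous (f : Cspace) : continuous f.
Proof. exact: set_mem (Cspace_funP f). Qed.

Lemma Cspace_bounded (f : Cspace) : bounded_values f.
Proof.
have cnf : {within [set: K], continuous (fun x => `|f x|)}.
  apply: continuous_subspaceT => x.
  by apply: cvg_norm; exact: Cspace_continuous.
have /compact_bounded[M [_ bM]] :=
  continuous_compact cnf (@compact_setT K).
exists (M + 1) => ? [x _ <-].
rewrite -[leLHS]ger0_norm //; apply: (bM (M + 1)); first by rewrite ltrDl.
by exists x.
Qed.

Let norm (f : Cspace) : R := supnorm f.

Let normD (f g : Cspace) : norm (f + g) <= norm f + norm g.
Proof. exact: supnormD (Cspace_bounded f) (Cspace_bounded g). Qed.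

Let normZ (a : R) (f : Cspace) : norm (a *: f) = `|a| * norm f.
Proof. exact: supnormZ (Cspace_bounded f) (Cspace_bounded (a *: f)). Qed.

Let norm0_eq0 (f : Cspace) : norm f = 0 -> f = 0.
Proof.
by move=> f0; apply/val_inj/funext; exact: supnorm0_eq0 (Cspace_bounded f) f0.
Qed.

HB.instance Definition _ :=
  Lmodule_isNormed.Build R Cspace normD normZ norm0_eq0.

Lemma Cspace_normE (f : Cspace) : `|f| = supnorm f.
Proof. by []. Qed.

End continuous_functions.

Section null_sequences.
Context (R : realType).

Definition c0carrier : {pred nat -> R} :=
  mem [set u : nat -> R | u @ \oo --> (0 : R)].

Lemma c0carrier_submod_closed : submod_closed c0carrier.
Proof.
split=> [|a u v /set_mem cu /set_mem cv]; apply/mem_set; first exact: cvg_cst.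
have -> : (0 : R) = a *: 0 + 0 by rewrite scaler0 addr0.
by apply: cvgD; [apply: cvgZr; exact: cu | exact: cv].
Qed.

HB.instance Definition _ :=
  GRing.isSubmodClosed.Build R (nat -> R) c0carrier c0carrier_submod_closed.

Record c0 := MkC0 {
  c0_seq :> nat -> R ;
  c0_seqP : c0_seq \in c0carrier
}.

HB.instance Definition _ := [isSub for c0_seq].
HB.instance Definition _ := [Choice of c0 by <:].
HB.instance Definition _ := [SubChoice_isSubLmodule of c0 by <:].

Lemma c0_cvg (u : c0) : u @ \oo --> (0 : R).
Proof. exact: set_mem (c0_seqP u). Qed.

Lemma c0_bounded (u : c0) : bounded_values u.
Proof.
have /cvg_seq_bounded[M [_ bM]] : cvgn u.
  by apply/cvg_ex; exists (0 : R); exact: c0_cvg.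
by exists (M + 1) => ? [n _ <-]; apply: (bM (M + 1)) => //; rewrite ltrDl.
Qed.

Let norm (u : c0) : R := supnorm u.

Let normD (u v : c0) : norm (u + v) <= norm u + norm v.
Proof. exact: supnormD (c0_bounded u) (c0_bounded v). Qed.

Let normZ (a : R) (u : c0) : norm (a *: u) = `|a| * norm u.
Proof. exact: supnormZ (c0_bounded u) (c0_bounded (a *: u)). Qed.

Let norm0_eq0 (u : c0) : norm u = 0 -> u = 0.
Proof.
by move=> u0; apply/val_inj/funext; exact: supnorm0_eq0 (c0_bounded u) u0.
Qed.

HB.instance Definition _ := Lmodule_isNormed.Build R c0 normD normZ norm0_eq0.

Lemma c0_normE (u : c0) : `|u| = supnorm u.
Proof. by []. Qed.

End null_sequences.

Section operators.
Context (R : realType).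
Implicit Types V W : normedModType R.

Definition bounded_operator V W (T : {linear V -> W}) :=
  exists M : R, forall x, `|T x| <= M * `|x|.

(* S is the inverse of T : V -> range T; its values off range T are
   irrelevant, and its linearity on range T is automatic. *)
Definition isomorphic_embedding V W (T : {linear V -> W}) :=
  [/\ bounded_operator T, closed (range T) &
      exists S : W -> V, cancel T S /\
        exists M : R, forall y, range T y -> `|S y| <= M * `|y|].

Definition closed_subspace W (Y : set W) :=
  [/\ closed Y, Y 0 & forall (a : R) x y, Y x -> Y y -> Y (a *: x + y)].

Definition isomorphic_to V W (Y : set W) :=
  exists S : {linear V -> W}, isomorphic_embedding S /\ range S = Y.

Definition complemented W (Y : set W) :=
  exists P : {linear W -> W},
    [/\ bounded_operator P, forall x, P (P x) = P x & range P = Y].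

End operators.

(* Measurable types of the library are pointed, whence the base point x0,
   which is otherwise irrelevant. *)
Definition pointed_at (K : topologicalType) (x0 : K) : Type := K.

HB.instance Definition _ (K : topologicalType) (x0 : K) :=
  Topological.on (pointed_at x0).
HB.instance Definition _ (K : topologicalType) (x0 : K) :=
  isPointed.Build (pointed_at x0) x0.

Definition borel (K : topologicalType) (x0 : K) :=
  g_sigma_algebraType (@open (pointed_at x0)).

Definition radon (K : topologicalType) (x0 : K) (R : realType)
    (mu : probability (borel x0) R) :=
  forall A : set (borel x0), measurable A ->
    mu A = ereal_sup
      [set mu C | C in [set C : set K | compact C /\ C `<=` A]].

Definition separable_L1 d (T : measurableType d) (R : realType)
    (mu : {measure set T -> \bar R}) :=
  exists D : set (LspaceType1 mu), countable D /\
    forall (f : LspaceType1 mu) (e : R), 0 < e ->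
      exists2 g : LspaceType1 mu, D g &
        ('N[mu]_1[EFin \o (f \- g)%R] < e%:E)%E.

(* If K is empty there is no x0, and indeed no probability on K. *)
Definition class_MS (R : realType) (K : topologicalType) :=
  forall (x0 : K) (mu : probability (borel x0) R),
    radon mu -> separable_L1 mu.

(* Main.v *)
(** Let [f_n = T e_n] and choose points [x_n] with [|f_n(x_n)|] bounded below.
    Since [sum_n |f_n(y)|] is bounded uniformly in [y], a gliding hump makes
    [sum_(m <> n) |f_m(x_n)|] small along a subsequence. In the class (MS) some
    averages of the point evaluations at the [x_n] over consecutive blocks
    converge weak*; differences of consecutive averages are then weak*-null and
    almost biorthogonal to the corresponding blocks of the [f_n], and a Neumann
    series on [c0] turns them into a projection.

    For the convergence of averages, suppose that every sequence [t] of averages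
    refining a given one oscillates on some function, scaled so that two
    refinements of [t] differ by at least 1 on it; pass to their midpoints.
    Iterate along a maximal chain for this relation. By diagonalization,
    countably many members of the chain have a strict lower bound in it, so every
    measure that is a limit along the chain makes these functions far apart in
    [L1] from countably many of their predecessors, which contradicts
    separability. *)
From HB Require Import structures.
Require Import Defs.
From mathcomp Require Import all_boot all_order all_algebra.
From mathcomp Require Import all_classical all_reals all_analysis.
From mathcomp Require Import measurable_realfun ring lra.

Set Implicit Arguments.
Unset Strict Implicit.
Unset Printing Implicit Defensive.

Import Order.TTheory GRing.Theory Num.Theory.
Import numFieldNormedType.Exports.

Local Open Scope classical_set_scope.
Local Open Scope ring_scope.

(** * Functionals on [C(K)] *)

Section Cspace_operations.
Context {R : realType} {K : compactHausdorffType}.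
Implicit Types (f g : Cspace K R) (a : R) (x : K).

Definition Cfun (f : K -> R) (cf : continuous f) : Cspace K R :=
  MkCspace (mem_set cf).

Lemma CspaceP f g : f =1 g -> f = g.
Proof. by move=> fg; apply/val_inj/funext. Qed.

Lemma Cspace_addE f g x : (f + g) x = f x + g x. Proof. by []. Qed.
Lemma Cspace_oppE f x : (- f) x = - f x. Proof. by []. Qed.
Lemma Cspace_scaleE a f x : (a *: f) x = a * f x. Proof. by []. Qed.
Lemma Cspace_zeroE x : (0 : Cspace K R) x = 0. Proof. by []. Qed.

Lemma Ccst_continuous a : continuous (fun _ : K => a).
Proof. by move=> x; exact: cvg_cst. Qed.
Definition Ccst a := Cfun (@Ccst_continuous a).

Lemma Cabs_continuous f : continuous (fun x => `|f x|).
Proof. by move=> x; apply: cvg_norm; exact: Cspace_continuous. Qed.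
Definition Cabs f := Cfun (@Cabs_continuous f).

Lemma Cmul_continuous f g : continuous (fun x => f x * g x).
Proof. by move=> x; apply: cvgM; exact: Cspace_continuous. Qed.
Definition Cmul f g := Cfun (@Cmul_continuous f g).

Lemma Ccut_continuous f a : continuous (fun x => Num.max (f x - a) 0).
Proof.
rewrite (_ : (fun x => _) = fun x => (f x - a + `|f x - a|) / 2); last first.
  by apply/funext => x; rewrite maxr_absE addr0 subr0.
move=> x; apply: cvgMr_tmp; apply: cvgD; last apply: cvg_norm;
  by apply: cvgB; [exact: Cspace_continuous|exact: cvg_cst].
Qed.
Definition Ccut f a := Cfun (@Ccut_continuous f a).

Lemma Ccst_E a x : Ccst a x = a. Proof. by []. Qed.
Lemma Cabs_E f x : Cabs f x = `|f x|. Proof. by []. Qed.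
Lemma Cmul_E f g x : Cmul f g x = f x * g x. Proof. by []. Qed.
Definition CspaceE := (Cspace_addE, Cspace_oppE, Cspace_scaleE, Cspace_zeroE,
  Ccst_E, Cabs_E, Cmul_E).

Lemma Ccut_geB f a x : f x - a <= Ccut f a x.
Proof. by rewrite /= le_max lexx. Qed.

Lemma Ccut_ge0 f a x : 0 <= Ccut f a x.
Proof. by rewrite /= le_max lexx orbT. Qed.

Lemma Ccut_le f a x : 0 <= a -> 0 <= f x -> Ccut f a x <= f x.
Proof. by move=> a0 f0; rewrite /= ge_max f0 andbT gerBl. Qed.

Lemma Ccut_eq0 f a x : f x <= a -> Ccut f a x = 0.
Proof. by move=> fa; apply: max_r; rewrite subr_le0. Qed.

Lemma Cspace_le_norm f x : `|f x| <= `|f|.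
Proof. exact: le_supnorm (Cspace_bounded f). Qed.

Lemma Cspace_separation (A B : set K) : closed A -> closed B ->
  A `&` B = set0 -> exists f,
  [/\ forall x, 0 <= f x <= 1, forall x, A x -> f x = 0 & forall x, B x -> f x = 1].
Proof.
move=> cA cB AB0.
have nK := compact_normal (@hausdorff_setT K) (@compact_setT K).
have := (normal_separatorP (R := R) (T := K)).1 nK A B cA cB AB0.
move=> /(uniform_separatorP (R := R))[f [cf f01 f0 f1]]; exists (Cfun cf); split=> x.
- by have /f01 : range f (f x) by []; rewrite /= in_itv.
- by move=> Ax; apply: f0; exists x.
- by move=> Bx; apply: f1; exists x.
Qed.

Lemma Cspace_open_gt f a : open [set x | a < f x].
Proof.
apply: (@open_comp _ _ f [set y | a < y]); last exact: open_gt.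
by move=> x _; exact: Cspace_continuous.
Qed.

Lemma Cspace_closed_ge f a : closed [set x | a <= f x].
Proof.
apply: (@closed_comp _ _ f [set y | a <= y]); last exact: closed_ge.
by move=> x _; exact: Cspace_continuous.
Qed.

End Cspace_operations.

Section states.
Context {R : realType} {K : compactHausdorffType}.

(** Positive normalized functionals stand in for probability Radon measures. Boundedness is not a
    field, since positivity and the value 1 at the constant 1 give it, see [state_ler_norm]. *)
Record state := State {
  state_fun :> Cspace K R -> R ;
  stateP : forall a (f g : Cspace K R), state_fun (a *: f + g) = a * state_fun f + state_fun g ;
  state_ge0 : forall f : Cspace K R, (forall x : K, 0 <= f x) -> 0 <= state_fun f ;
  state1 : state_fun (Ccst 1) = 1 }.

Implicit Types (L : state) (f g : Cspace K R).

Lemma state0 L : L 0 = 0.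
Proof. by have := stateP L (-1) 0 0; rewrite scaler0 addr0 mulN1r addNr. Qed.

Lemma stateD L f g : L (f + g) = L f + L g.
Proof. by have := stateP L 1 f g; rewrite scale1r mul1r. Qed.

Lemma stateZ L a f : L (a *: f) = a * L f.
Proof. by have := stateP L a f 0; rewrite !addr0 state0 addr0. Qed.

Lemma stateN L f : L (- f) = - L f.
Proof. by rewrite -scaleN1r stateZ mulN1r. Qed.

Lemma stateB L f g : L (f - g) = L f - L g.
Proof. by rewrite stateD stateN. Qed.

Lemma state_le L f g : (forall x, f x <= g x) -> L f <= L g.
Proof.
by move=> fg; rewrite -subr_ge0 -stateB; apply: state_ge0 => x; rewrite !CspaceE subr_ge0.
Qed.

Lemma state_cst L a : L (Ccst a) = a.
Proof.
rewrite (_ : Ccst a = a *: Ccst 1) ?stateZ ?state1 ?mulr1//.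
by apply: CspaceP => x; rewrite !CspaceE mulr1.
Qed.

Lemma state_ler_abs L f : `|L f| <= L (Cabs f).
Proof.
rewrite ler_norml -stateN; apply/andP; split; apply: state_le => x; rewrite ?CspaceE /=.
  by rewrite lerNl ler_normr lexx orbT.
exact: ler_norm.
Qed.

Lemma state_ler_norm L f : `|L f| <= `|f|.
Proof.
apply: (le_trans (state_ler_abs L f)); rewrite -[leRHS](state_cst L).
by apply: state_le => x; exact: Cspace_le_norm.
Qed.

End states.
Arguments state R K : clear implicits.

(** * The representing measure of a state *)

Section open_content.
Context {R : realType} {K : compactHausdorffType} (L : state R K).
Implicit Types (U V A : set K) (f g : Cspace K R).

(** The test functions of the Riesz content of [U]. They vanish off [U] but need not have their
    support inside it; [state_le_cut] remedies this. *)
Definition subordinate U f :=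
  (forall x, 0 <= f x <= 1) /\ forall x, ~ U x -> f x = 0.

Definition open_content U := sup [set L f | f in subordinate U].

Lemma subordinate0 U : subordinate U 0.
Proof. by split=> // x; rewrite CspaceE lexx ler01. Qed.

Lemma subordinate_le1 U f : subordinate U f -> L f <= 1.
Proof.
by move=> [f01 _]; rewrite -[leRHS](state1 L); apply: state_le => x; have /andP[] := f01 x.
Qed.

Lemma open_content_ub U f : subordinate U f -> L f <= open_content U.
Proof.
by move=> Uf; apply: ub_le_sup; [exists 1 => _ [g /subordinate_le1 ? <-]|exists f].
Qed.

Lemma open_content_le U a :
  (forall f, subordinate U f -> L f <= a) -> open_content U <= a.
Proof.
move=> h; apply: ge_sup => [|_ [f Uf <-]]; last exact: h.
by exists (L 0), 0 => //; exact: subordinate0.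
Qed.

Lemma open_content_adherent U e : 0 < e ->
  exists2 f, subordinate U f & open_content U < L f + e.
Proof.
move=> e0; have [|_ [f Uf <-] h] := @sup_adherent _ [set L f | f in subordinate U] e e0.
  split; first by exists (L 0), 0 => //; exact: subordinate0.
  by exists 1 => _ [g /subordinate_le1 ? <-].
by exists f => //; rewrite -ltrBlDr.
Qed.

Lemma open_content_ge0 U : 0 <= open_content U.
Proof. by rewrite -(state0 L); apply: open_content_ub; exact: subordinate0. Qed.

Lemma open_content_le1 U : open_content U <= 1.
Proof. by apply: open_content_le => f; exact: subordinate_le1. Qed.

Lemma open_contentS U V : U `<=` V -> open_content U <= open_content V.
Proof.
move=> UV; apply: open_content_le => f [f01 f0]; apply: open_content_ub.
by split=> // x Vx; apply: f0; apply: contra_not Vx; exact: UV.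
Qed.

Lemma open_content_set0 : open_content set0 = 0.
Proof.
apply/eqP; rewrite eq_le open_content_ge0 andbT; apply: open_content_le => f [_ f0].
by rewrite (_ : f = 0) ?state0//; apply: CspaceP => x; rewrite f0.
Qed.

Lemma open_content_setT : open_content setT = 1.
Proof.
apply/eqP; rewrite eq_le open_content_le1 /= -(state1 L); apply: open_content_ub.
by split=> [x|x /(_ I)]//; apply/andP; split; [exact: ler01|exact: lexx].
Qed.

(** Where the cut is nonzero, [e < f]. So for [f] subordinate to [U] and [e > 0] the cut lives in a
    closed subset of [U], and this costs at most [e]. *)
Lemma state_le_cut f e : L f <= L (Ccut f e) + e.
Proof.
rewrite -[X in _ + X](state_cst L) -stateD; apply: state_le => x.
by rewrite CspaceE -lerBlDr Ccut_geB.
Qed.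

Lemma open_contentU U V : open U -> open V ->
  open_content (U `|` V) <= open_content U + open_content V.
Proof.
move=> oU oV; apply: open_content_le => f [f01 f0]; apply/ler_addgt0Pr => e e0.
(* A point outside [V] where [e <= f] lies in [U], so some [g] vanishes off [U] and is 1 at all such
   points. The pieces of the cut of [f] weighted by [g] and [1 - g] are subordinate to [U] and
   [V]. *)
have [|||g [g01 g0 g1]] := @Cspace_separation R K (~` U) ([set x | e <= f x] `&` ~` V).
- exact: open_closedC.
- by apply: closedI; [exact: Cspace_closed_ge|exact: open_closedC].
- apply/seteqP; split=> // x [Ux [/= fx Vx]].
  by move: fx; rewrite f0 ?leNgt ?e0// => -[].
have fe1 x : Ccut f e x <= 1.
  have /andP[f0x f1x] := f01 x.
  by apply: le_trans f1x; apply: Ccut_le => //; exact: ltW.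
have Uf : subordinate U (Cmul (Ccut f e) g).
  split=> x; last by move=> /g0 gx; rewrite CspaceE gx mulr0.
  have /andP[g0x g1x] := g01 x; apply/andP; split.
    by apply: mulr_ge0 => //; exact: Ccut_ge0.
  by apply: mulr_ile1 => //; exact: Ccut_ge0.
have Vf : subordinate V (Cmul (Ccut f e) (Ccst 1 - g)).
  split=> x.
    have /andP[g0x g1x] := g01 x; rewrite !CspaceE.
    have := Ccut_ge0 f e x; have := fe1 x; nra.
  move=> Vx; rewrite !CspaceE; have [efx|/ltW fxe] := leP e (f x).
    by rewrite g1// subrr mulr0.
  by rewrite Ccut_eq0// mul0r.
rewrite (le_trans (state_le_cut f e))// lerD2r.
rewrite (_ : Ccut f e = Cmul (Ccut f e) g + Cmul (Ccut f e) (Ccst 1 - g)).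
  by rewrite stateD lerD// open_content_ub.
apply: CspaceP => x; rewrite !CspaceE; ring.
Qed.

Lemma open_content_bigcup_lt (U : nat -> set K) n : (forall i, open (U i)) ->
  open_content [set x | exists2 i, (i < n)%N & U i x] <= \sum_(i < n) open_content (U i).
Proof.
move=> oU; elim: n => [|n ih].
  rewrite big_ord0 (_ : [set _ | _] = set0) ?open_content_set0//.
  by apply/seteqP; split=> // x [].
rewrite big_ord_recr /=; apply: le_trans (lerD ih (lexx _)).
apply: le_trans (open_contentU _ _) => //; last first.
  rewrite (_ : [set _ | _] = \bigcup_(i in `I_n) U i); first exact: bigcup_open.
  by apply/seteqP; split.
apply: open_contentS => x [i + Uix]; rewrite ltnS leq_eqVlt => /orP[/eqP <-|lin].
  by right.
by left; exists i.
Qed.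

Lemma open_content_sigma_subadditive (U : nat -> set K) : (forall i, open (U i)) ->
  ((open_content (\bigcup_i U i))%:E <= \sum_(i <oo) (open_content (U i))%:E)%E.
Proof.
move=> oU; apply/lee_addgt0Pr => e e0.
pose U_ n := [set x | exists2 i, (i < n)%N & U i x].
suff [n Un] : exists n, open_content (\bigcup_i U i) <= open_content (U_ n) + e.
  apply: (@le_trans _ _ ((\sum_(i < n) (open_content (U i))%:E) + e%:E)%E).
    rewrite sumEFin -EFinD lee_fin (le_trans Un)// lerD2r.
    exact: open_content_bigcup_lt.
  rewrite leeD2r// -(big_mkord xpredT (fun i => (open_content (U i))%:E)).
  by apply: nneseries_lim_ge => i _; rewrite lee_fin open_content_ge0.
(* Half of [e] pays for an almost optimal [f], half for cutting it; what the cut leaves lives on a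
   compact set, which finitely many [U i] cover. *)
have e20 : 0 < e / 2 by rewrite divr_gt0.
have [f [f01 f0] fe] := open_content_adherent (\bigcup_i U i) e20.
have cC : compact [set x | e / 2 <= f x].
  by apply: subclosed_compact (@compact_setT K) _ => //; exact: Cspace_closed_ge.
have : \forall n \near \oo, [set x | e / 2 <= f x] `<=` U_ n.
  apply: (compact_near_coveringP _).1 cC _ _ _ _ _ => x /= fx.
  have [i _ Uix] : (\bigcup_i U i) x.
    by apply: contrapT => /f0 f0x; move: fx; rewrite f0x leNgt e20.
  exists (U i, [set n | (i < n)%N]) => [|[y n] /= [Uiy lin]]; last by exists i.
  by split=> /=; [apply: open_nbhs_nbhs|exact: nbhs_infty_gt].
case=> n _ /(_ n (leqnn n)) Cn; exists n.
rewrite (le_trans (ltW fe))// [in leRHS](splitr e) addrA lerD2r.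
rewrite (le_trans (state_le_cut f (e / 2)))// lerD2r.
apply: open_content_ub; split=> x.
  have /andP[f0x f1x] := f01 x; rewrite Ccut_ge0 /= (le_trans _ f1x)// Ccut_le//.
  exact: ltW.
by move=> Unx; apply: Ccut_eq0; apply: ltW; rewrite ltNge; apply/negP => /Cn/Unx.
Qed.

Definition outer_content A :=
  inf [set open_content U | U in [set U | open U /\ A `<=` U]].

Lemma outer_content_le A U : open U -> A `<=` U -> outer_content A <= open_content U.
Proof.
move=> oU AU; apply: ge_inf; last by exists U.
by exists 0 => _ [V _ <-]; exact: open_content_ge0.
Qed.

Lemma outer_content_lb A a :
  (forall U, open U -> A `<=` U -> a <= open_content U) -> a <= outer_content A.
Proof.
move=> h; apply: lb_le_inf => [|_ [U [oU AU] <-]]; last exact: h.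
by exists (open_content setT), setT; split=> //; exact: openT.
Qed.

Lemma outer_content_ge0 A : 0 <= outer_content A.
Proof. by apply: outer_content_lb => U _ _; exact: open_content_ge0. Qed.

Lemma outer_content_adherent A e : 0 < e ->
  exists U, [/\ open U, A `<=` U & open_content U < outer_content A + e].
Proof.
move=> e0; set S := [set open_content U | U in [set U | open U /\ A `<=` U]].
have [|_ [U [oU AU] <-] h] := @inf_adherent _ S e e0; last by exists U.
split; first by exists (open_content setT), setT; split=> //; exact: openT.
by exists 0 => _ [V _ <-]; exact: open_content_ge0.
Qed.

Lemma outer_content_open U : open U -> outer_content U = open_content U.
Proof.
move=> oU; apply/eqP; rewrite eq_le outer_content_le//=.
by apply: outer_content_lb => V _; exact: open_contentS.
Qed.

Definition outer_contente A : \bar R := (outer_content A)%:E.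

Lemma outer_contente0 : outer_contente set0 = 0%E.
Proof.
by rewrite /outer_contente outer_content_open ?open_content_set0//; exact: open0.
Qed.

Lemma outer_contente_ge0 A : (0 <= outer_contente A)%E.
Proof. by rewrite lee_fin outer_content_ge0. Qed.

Lemma le_outer_contente : {homo outer_contente : A B / A `<=` B >-> (A <= B)%E}.
Proof.
move=> A B AB; rewrite lee_fin; apply: outer_content_lb => U oU BU.
by apply: outer_content_le => //; exact: subset_trans BU.
Qed.

Lemma outer_contente_sigma_subadditive : sigma_subadditive outer_contente.
Proof.
move=> F; apply/lee_addgt0Pr => e e0.
have /choice[U UP] n : exists U, [/\ open U, F n `<=` U &
    open_content U < outer_content (F n) + e / (2 ^ n.+1)%:R].
  by apply: outer_content_adherent; rewrite divr_gt0// ltr0n expn_gt0.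
have F0 n := outer_contente_ge0 (F n).
apply: le_trans (epsilon_trick xpredT F0 (ltW e0)).
apply: (@le_trans _ _ (open_content (\bigcup_n U n))%:E).
  rewrite lee_fin; apply: outer_content_le.
    by apply: bigcup_open => n _; have [] := UP n.
  by move=> x [n _ Fx]; exists n => //; have [_ + _] := UP n; exact.
apply: (le_trans (open_content_sigma_subadditive _)).
  by move=> n; have [] := UP n.
apply: lee_nneseries => n _; first by rewrite lee_fin open_content_ge0.
by rewrite -EFinD lee_fin ltW//; have [] := UP n.
Qed.

HB.instance Definition _ := isOuterMeasure.Build R K outer_contente
  outer_contente0 outer_contente_ge0 le_outer_contente outer_contente_sigma_subadditive.

(** The hard half of the Carathéodory condition. The part of [V] outside [U] lies in the open part
    [W] of [V] where [f < e / 2]; a test function of [W] and the cut of [f] are nowhere both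
    nonzero, so their sum is a test function of [V]. *)
Lemma open_content_disjoint U V f : open U -> open V -> U `<=` V -> subordinate U f ->
  forall e, 0 < e -> L f + outer_content (V `\` U) <= open_content V + e.
Proof.
move=> oU oV UV [f01 f0] e e0; pose W := V `&` ~` [set x | e / 2 <= f x].
have e20 : 0 < e / 2 by rewrite divr_gt0.
have oW : open W by apply: openI => //; apply: closed_openC; exact: Cspace_closed_ge.
have [g [g01 g0] gW] := open_content_adherent W e20.
have VW : outer_content (V `\` U) <= open_content W.
  apply: outer_content_le => // x [Vx /f0 fx]; split=> //=.
  by rewrite fx; apply/negP; rewrite -ltNge.
have fgV : subordinate V (Ccut f (e / 2) + g).
  split=> x.
    have /andP[f0x f1x] := f01 x; have /andP[g0x g1x] := g01 x.
    have fc0 := Ccut_ge0 f (e / 2) x; have fc1 := Ccut_le (ltW e20) f0x.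
    rewrite CspaceE; apply/andP; split; first exact: addr_ge0.
    have [efx|/ltW fxe] := leP (e / 2) (f x).
      by rewrite g0 ?addr0 ?(le_trans fc1)// => -[_]; exact.
    by rewrite Ccut_eq0// add0r.
  move=> Vx; rewrite CspaceE g0; last by move=> -[].
  by rewrite Ccut_eq0 ?addr0// f0 ?(ltW e20)// => /UV.
have := open_content_ub fgV; rewrite stateD.
have := state_le_cut f (e / 2); lra.
Qed.

Lemma open_caratheodory U : open U -> outer_contente.-caratheodory U.
Proof.
move=> oU; apply: le_caratheodory_measurable => A.
rewrite -EFinD lee_fin; apply: outer_content_lb => V oV AV.
have oVU := openI oV oU.
apply/ler_addgt0Pr => e e0; have e20 : 0 < e / 2 by rewrite divr_gt0.
have [f VUf fVU] := open_content_adherent (V `&` U) e20.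
have := open_content_disjoint oVU oV (@subIsetl _ _ _) VUf e20.
have : outer_content (A `&` U) <= open_content (V `&` U).
  by apply: outer_content_le => //; exact: setSI.
have : outer_content (A `&` ~` U) <= outer_content (V `\` (V `&` U)).
  rewrite -lee_fin; apply: le_outer_contente => x [Ax Ux].
  by split; [exact: AV|move=> [_]; exact: Ux].
lra.
Qed.

End open_content.

Section borel_sets.
Context {R : realType} {K : compactHausdorffType} (x0 : K).

Lemma measurable_open_borel (U : set K) : open U -> measurable (U : set (borel x0)).
Proof. by move=> oU; apply: sub_gen_smallest. Qed.

Lemma measurable_compact_borel (C : set K) :
  compact C -> measurable (C : set (borel x0)).
Proof.
move=> cC; rewrite -(setCK C); apply: measurableC; apply: measurable_open_borel.
by apply: closed_openC; apply: compact_closed => //; exact: hausdorff_setT.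
Qed.

Lemma measurable_Cspace_borel (f : Cspace K R) :
  measurable_fun [set: borel x0] (f : borel x0 -> R).
Proof.
apply: (measurability _ (RGenOpens.measurableE R)) => _ [_ [a [b ->] <-]].
rewrite setTI; apply: measurable_open_borel.
apply: (@open_comp _ _ f); last exact: interval_open.
by move=> x _; exact: Cspace_continuous.
Qed.

End borel_sets.

Section representing_measure.
Context {R : realType} {K : compactHausdorffType} (L : state R K) (x0 : K).

Definition representing_measure : set (borel x0) -> \bar R := outer_contente L.
Local Notation mu := representing_measure.

Lemma borel_caratheodory (A : set (borel x0)) :
  measurable A -> (outer_contente L).-caratheodory A.
Proof.
move: A; apply: smallest_sub => [|U oU]; last exact: open_caratheodory.
exact: (sigma_algebra_measurable (caratheodory_type
  (outer_contente L : set (pointed_at x0) -> \bar R))).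
Qed.

Lemma representing_measure_sigma_additive : semi_sigma_additive mu.
Proof.
move=> F mF tF mUF.
apply: (@caratheodory_measure_sigma_additive R (pointed_at x0) (outer_contente L)) => //.
- by move=> i; exact: borel_caratheodory.
- exact: borel_caratheodory.
Qed.

HB.instance Definition _ := isMeasure.Build _ (borel x0) R mu
  (outer_contente0 L) (outer_contente_ge0 L) representing_measure_sigma_additive.

Lemma representing_measure_setT : mu setT = 1%E.
Proof.
rewrite /mu /outer_contente outer_content_open ?open_content_setT//.
exact: openT.
Qed.

HB.instance Definition _ :=
  Measure_isProbability.Build _ (borel x0) R mu representing_measure_setT.

Lemma representing_measure_open (U : set K) :
  open U -> mu U = (open_content L U)%:E.
Proof. by move=> oU; rewrite /mu /outer_contente outer_content_open. Qed.

Lemma representing_measure_radon : radon mu.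
Proof.
move=> A mA; apply/eqP; rewrite eq_le; apply/andP; split; last first.
  apply: ge_ereal_sup => _ [C [cC CA] <-].
  apply: le_measure => //; rewrite inE //.
  exact: measurable_compact_borel.
apply/lee_addgt0Pr => e e0.
(* Outer regularity of the complement of [A] is inner regularity of [A]: the complement of [U] is
   closed, hence compact, and lies in [A]. *)
have [U [oU AU Ue]] := outer_content_adherent L (~` A) e0.
have mU := measurable_open_borel (x0 := x0) oU.
apply: (@le_trans _ _ (mu (~` U) + e%:E)%E); last first.
  rewrite leeD2r//; apply: ereal_sup_ubound; exists (~` U) => //; split.
    apply: subclosed_compact (@compact_setT K) _ => //; exact: open_closedC.
  by rewrite -[X in _ `<=` X]setCK; exact: subsetC.
have AC : mu (~` A) = (1 - mu A)%E by exact: probability_setC.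
have -> : mu (~` U) = (1 - mu U)%E by exact: probability_setC.
rewrite representing_measure_open//; move: AC; rewrite /mu /outer_contente.
rewrite -!EFinB -EFinD lee_fin => -[]; move: Ue; lra.
Qed.

(** Layer cake with layers of thickness [eta]. The bottom layer [h - h'], divided by [eta], is
    subordinate to the set where [h > 0]. For the rest [h'] the induction leaves an error on the set
    where [h > eta], and there [h] exceeds [h'] by [eta]. *)
Lemma state_le_integral_add (eta : R) n (h : Cspace K R) : 0 < eta ->
  (forall x, 0 <= h x <= eta *+ n) ->
  ((L h)%:E <= \int[mu]_x (h x)%:E + eta%:E * mu [set x | (0 < h x)%R])%E.
Proof.
move=> eta0; elim: n h => [|n ih] h h0n.
  rewrite (_ : h = 0) ?state0; last first.
    by apply: CspaceP => x; apply/eqP; rewrite eq_le andbC; exact: h0n.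
  apply: adde_ge0; last by rewrite mule_ge0// lee_fin ltW.
  by apply: integral_ge0 => x _; rewrite lee_fin CspaceE.
have h0 x : 0 <= h x by have /andP[] := h0n x.
pose h' := Ccut h eta.
have h'h x : h' x <= h x by apply: Ccut_le => //; exact: ltW.
have h'0 x : 0 <= h' x by exact: Ccut_ge0.
have mh (g : Cspace K R) : measurable_fun [set: borel x0] (EFin \o (g : borel x0 -> R)).
  by apply/measurable_EFinP; exact: measurable_Cspace_borel.
have h'gt0 : [set x | 0 < h' x] = [set x | eta < h x].
  apply/seteqP; split=> x /=; rewrite lt_max ltxx orbF subr_gt0//.
have mU : measurable ([set x | eta < h x] : set (borel x0)).
  by apply: measurable_open_borel; exact: Cspace_open_gt.
have low : (L (h - h') <= eta * open_content L [set x | (0 < h x)%R])%R.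
  rewrite mulrC -ler_pdivrMr// mulrC -stateZ; apply: open_content_ub; split=> x.
    have hc : h x - eta <= h' x by exact: Ccut_geB.
    rewrite !CspaceE mulrC ler_pdivrMr// mul1r; apply/andP; split; last by lra.
    by rewrite divr_ge0 ?subr_ge0 ?(ltW eta0).
  move=> /negP; rewrite -leNgt => hx.
  have hx0 : h x = 0 by apply/eqP; rewrite eq_le hx h0.
  have hx'0 : h' x = 0 by apply: Ccut_eq0; rewrite hx0 ltW.
  by rewrite !CspaceE hx0 hx'0 subrr mulr0.
have ih' : ((L h')%:E <= \int[mu]_x (h' x)%:E + eta%:E * mu [set x | (eta < h x)%R])%E.
  rewrite -h'gt0; apply: ih => x; apply/andP; split=> //.
  rewrite ge_max; apply/andP; split; last by rewrite mulrn_wge0// ltW.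
  by have /andP[_] := h0n x; rewrite mulrSr; lra.
have up : (\int[mu]_x (h' x)%:E + eta%:E * mu [set x | (eta < h x)%R]
    <= \int[mu]_x (h x)%:E)%E.
  pose U : set (borel x0) := [set x | eta < h x].
  have mI : measurable_fun [set: borel x0] (EFin \o (\1_U : borel x0 -> R)).
    by apply/measurable_EFinP; exact: measurable_indic.
  have IU : (\int[mu]_x (eta%:E * (\1_U x)%:E) = eta%:E * mu U)%E.
    rewrite ge0_integralZl ?lee_fin ?ltW//.
    by rewrite integral_indic// setIT.
  have mIU : measurable_fun [set: borel x0] (fun x => (eta%:E * (\1_U x)%:E)%E).
    exact: measurable_funeM.
  have IU0 x : (0 <= eta%:E * (\1_U x)%:E)%E by rewrite mule_ge0// lee_fin ltW.
  have <- : (\int[mu]_x ((h' x)%:E + eta%:E * (\1_U x)%:E) =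
      \int[mu]_x (h' x)%:E + eta%:E * mu U)%E.
    rewrite -IU; apply: ge0_integralD => //; last exact: mh.
    by move=> x _; rewrite lee_fin.
  apply: ge0_le_integral => //.
  - by move=> x _; rewrite adde_ge0// lee_fin.
  - by apply: emeasurable_funD => //; exact: mh.
  - exact: mh.
  move=> x _; rewrite -EFinM -EFinD lee_fin indicE; case: (boolP (x \in _)).
    by rewrite inE /U /= => hx; rewrite mulr1 /h' /= max_l; lra.
  by rewrite mulr0 addr0.
have oU : open [set x | 0 < h x] by exact: Cspace_open_gt.
have -> : L h = L h' + L (h - h') by rewrite -stateD addrC subrK.
rewrite EFinD leeD//; first exact: le_trans ih' up.
by rewrite representing_measure_open// -EFinM lee_fin.
Qed.

Lemma state_le_integral (h : Cspace K R) : (forall x, 0 <= h x) ->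
  ((L h)%:E <= \int[mu]_x (h x)%:E)%E.
Proof.
move=> h0; apply/lee_addgt0Pr => e e0.
have [n hn] : exists n, `|h| <= e *+ n.
  exists (Num.bound (`|h| / e)); rewrite -mulr_natl -ler_pdivrMr//.
  by apply: ltW; apply: archi_boundP; rewrite divr_ge0// ltW.
apply: (le_trans (@state_le_integral_add e n h e0 _)) => [x|].
  by rewrite h0 (le_trans _ hn)// (le_trans (ler_norm _))// Cspace_le_norm.
rewrite leeD2l// -[leRHS]mule1 lee_wpmul2l ?lee_fin ?(ltW e0)//.
by rewrite outer_content_open ?open_content_le1//; exact: Cspace_open_gt.
Qed.

End representing_measure.

(** * Refinements by convex combinations *)

Section finer_sequences.
Context {R : realType} {K : compactHausdorffType}.
Local Notation state := (state R K).
Implicit Types (p q r : state) (A B : set state) (s t u : nat -> state).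
Implicit Types (f g : Cspace K R).

(** [conv_mix] fixes only the values of [r], so no equality between states, with their proof fields,
    has to be shown. *)
Inductive conv A : set state :=
| conv_in p : A p -> conv A p
| conv_mix c p q r : 0 <= c <= 1 -> conv A p -> conv A q ->
    (forall f, r f = c * p f + (1 - c) * q f) -> conv A r.

Lemma conv_sub A B : A `<=` conv B -> conv A `<=` conv B.
Proof.
by move=> AB p; elim=> [|c p1 q r c01 _ ? _ ? rE]; [exact: AB|exact: (conv_mix c01 _ _ rE)].
Qed.

Lemma convS A B : A `<=` B -> conv A `<=` conv B.
Proof. by move=> AB; apply: conv_sub => p /AB; exact: conv_in. Qed.

Lemma conv_le A f a : (forall p, A p -> p f <= a) -> forall p, conv A p -> p f <= a.
Proof.
move=> Aa p; elim=> [|c p1 q r /andP[c0 c1] _ pa _ qa rE]; first exact: Aa.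
rewrite rE; nra.
Qed.

Lemma conv_ge A f a : (forall p, A p -> a <= p f) -> forall p, conv A p -> a <= p f.
Proof.
move=> Aa p Ap; rewrite -lerN2 -stateN; apply: conv_le Ap => q /Aa.
by rewrite stateN lerN2.
Qed.

Lemma conv_diam A f a : (forall p q, A p -> A q -> p f - q f <= a) ->
  forall p q, conv A p -> conv A q -> p f - q f <= a.
Proof.
move=> Aa p q Ap Aq; rewrite lerBlDr -lerBlDl; apply: conv_ge Aq => r Ar.
rewrite lerBlDl -lerBlDr lerBlDr; apply: conv_le Ap => r' Ar'.
by rewrite -lerBlDr; exact: Aa.
Qed.

Definition mid_fun p q f := (p f + q f) / 2.

Lemma mid_funP p q a f g : mid_fun p q (a *: f + g) = a * mid_fun p q f + mid_fun p q g.
Proof. by rewrite /mid_fun !stateP; field. Qed.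

Lemma mid_fun_ge0 p q f : (forall x, 0 <= f x) -> 0 <= mid_fun p q f.
Proof. by move=> f0; rewrite divr_ge0// addr_ge0// state_ge0. Qed.

Lemma mid_fun1 p q : mid_fun p q (Ccst 1) = 1.
Proof. by rewrite /mid_fun !state1; field. Qed.

Definition mid p q := State (@mid_funP p q) (@mid_fun_ge0 p q) (mid_fun1 p q).

Lemma conv_mid A p q : conv A p -> conv A q -> conv A (mid p q).
Proof.
move=> Ap Aq; apply: (@conv_mix A (1 / 2) p q) => //; first by apply/andP; split; lra.
by move=> f; rewrite /= /mid_fun; field.
Qed.

Definition tail s m := [set s n | n in [set n | (m <= n)%N]].

Lemma tailS s m n : (m <= n)%N -> tail s n `<=` tail s m.
Proof. by move=> mn _ [k nk <-]; exists k => //; exact: leq_trans nk. Qed.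

(** As the terms of [t] eventually avoid every initial segment of [s], stability passes from [s] to
    [t]. Only late terms count, so a diagonal sequence can refine countably many sequences at
    once. *)
Definition finer t s := forall m, exists k0, forall k, (k0 <= k)%N -> conv (tail s m) (t k).

Lemma finer_refl s : finer s s.
Proof. by move=> m; exists m => k mk; apply: conv_in; exists k. Qed.

Lemma finer_tail t s m : finer t s -> exists k, conv (tail t k) `<=` conv (tail s m).
Proof.
by move=> ts; have [k kP] := ts m; exists k; apply: conv_sub => _ [n kn <-]; exact: kP.
Qed.

Lemma finer_trans t s u : finer t s -> finer s u -> finer t u.
Proof.
move=> ts su m; have [k kP] := finer_tail m su; have [k0 k0P] := ts k.
by exists k0 => n k0n; apply: kP; exact: k0P.
Qed.

Lemma finer_mid t t' s : finer t s -> finer t' s -> finer (fun n => mid (t n) (t' n)) s.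
Proof.
move=> ts ts' m; have [k kP] := ts m; have [k' kP'] := ts' m.
exists (maxn k k') => n; rewrite geq_max => /andP[kn k'n].
by apply: conv_mid; [exact: kP|exact: kP'].
Qed.

Lemma finer_subseq s (phi : nat -> nat) : (forall k, (k <= phi k)%N) -> finer (s \o phi) s.
Proof.
by move=> phik m; exists m => k mk; apply: conv_in; exists (phi k) => //; exact: leq_trans (phik k).
Qed.

(** The Cauchy condition for the values at [f]; exchanging [i] and [j] bounds the absolute value.
    Stability at every [f] is weak* convergence. *)
Definition stable s f := forall e, 0 < e ->
  exists m, forall i j, (m <= i)%N -> (m <= j)%N -> s i f - s j f <= e.

Lemma stable_conv s f e : stable s f -> 0 < e ->
  exists m, forall p q, conv (tail s m) p -> conv (tail s m) q -> p f - q f <= e.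
Proof.
move=> sf /sf[m mP]; exists m; apply: conv_diam.
by move=> _ _ [i mi <-] [j mj <-]; exact: mP.
Qed.

Lemma stable_finer t s f : finer t s -> stable s f -> stable t f.
Proof.
move=> ts sf e e0; have [m mP] := stable_conv sf e0; have [k kP] := ts m.
by exists k => i j ki kj; apply: mP; exact: kP.
Qed.

(** The halves [s0] and [s1] witness that [s] oscillates on [f], while [t] refines their midpoints
    and no longer oscillates on it. *)
Definition splits t s f := exists s0 s1, [/\ finer s0 s, finer s1 s,
  forall n, 1 <= s0 n f - s1 n f, finer t (fun n => mid (s0 n) (s1 n)) & stable t f].

Definition below t s := exists f, splits t s f.

Lemma below_finer t s : below t s -> finer t s.
Proof.
move=> [f [s0 [s1 [s0s s1s _ tm _]]]]; apply: finer_trans tm _; exact: finer_mid.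
Qed.

Lemma below_finer_trans u t s : below u t -> finer t s -> below u s.
Proof.
move=> [f [s0 [s1 [s0s s1s s01 tm tf]]]] ts; exists f, s0, s1; split=> //.
  exact: finer_trans ts.
exact: finer_trans ts.
Qed.

(** The halves of the splitting refine a sequence that is stable on [f], so their values at [f] come
    within 1/2 of each other, against the gap of 1. *)
Lemma below_irrefl s : ~ below s s.
Proof.
move=> [f [s0 [s1 [s0s s1s s01 _ sf]]]].
have e : 0 < 2^-1 :> R by rewrite invr_gt0.
have [m mP] := stable_conv sf e; have [k0 k0P] := s0s m; have [k1 k1P] := s1s m.
have := mP _ _ (k0P _ (leq_maxl k0 k1)) (k1P _ (leq_maxr k0 k1)).
by have := s01 (maxn k0 k1); lra.
Qed.

(* On functions on which s is stable, the two halves of the splitting agree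
   asymptotically, whereas they differ by 1 on f. *)
Lemma splits_far t s f g : splits t s f -> stable s g ->
  exists m, forall p, conv (tail t m) p -> 1 / 4 <= p (Cabs (f - g)).
Proof.
move=> [s0 [s1 [s0s s1s s01 tm _]]] sg.
(* As [g] varies by at most 1/2, the two halves differ by at least 1/2 on [f - g]. The midpoint
   averages the two values at the absolute value of [f - g], whence 1/4. *)
have e : 0 < 1 / 2 :> R by lra.
have [m mP] := stable_conv sg e.
have [k0 k0P] := s0s m; have [k1 k1P] := s1s m.
have [n nP] := finer_tail (maxn k0 k1) tm.
exists n => p /nP; apply: conv_ge => _ [k + <-]; rewrite /= geq_max => /andP[k0k k1k].
rewrite /= /mid_fun.
have := mP _ _ (k0P _ k0k) (k1P _ k1k); have := s01 k.
have := state_ler_abs (s0 k) (f - g); have := state_ler_abs (s1 k) (f - g).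
rewrite !ler_norml !stateB => /andP[? ?] /andP[? ?]; lra.
Qed.

(** Bolzano-Weierstrass with a rate. [phi] need not increase; [k <= phi k] is what [finer_subseq]
    asks for. *)
Lemma bounded_seq_cluster (u : nat -> R) (M : R) : (forall n, `|u n| <= M) ->
  exists2 phi : nat -> nat, (forall k, (k <= phi k)%N) &
    exists l, forall k, `|u (phi k) - l| <= k.+1%:R^-1.
Proof.
move=> uM; have cM := @segment_compact R (- M) M.
have uF : (u @ \oo) [set` `[- M, M]].
  by exists 0 => // n _; rewrite /= in_itv /= -ler_norml.
have [l [_ lP]] := cM (u @ \oo) _ uF.
have h k : exists n, (k <= n)%N /\ `|u n - l| <= k.+1%:R^-1.
  have [||_ [[n kn <-] ln]] := lP (u @` [set n | (k <= n)%N]) (ball l k.+1%:R^-1).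
  - by exists k => // n /= kn; exists n.
  - by apply: nbhsx_ballx; rewrite invr_gt0.
  - by exists n; split=> //; move: ln; rewrite /ball /= distrC => /ltW.
by have [phi phiP] := choice h; exists phi; [|exists l] => k; have [] := phiP k.
Qed.

Lemma exists_below s f : ~ stable s f -> exists t, below t s.
Proof.
move=> /existsNP[e /not_implyP[e0 /forallNP eP]].
have [i iP] := choice (fun m => (existsNP _).2 (eP m)).
have [j jP] := choice (fun m => (existsNP _).2 (iP m)).
have {}iP m : [/\ (m <= i m)%N, (m <= j m)%N & e < s (i m) f - s (j m) f].
  by have /not_implyP[? /not_implyP[? /negP]] := jP m; rewrite -ltNge.
(* Dividing by [e] turns the oscillation of [f] into the gap 1. The midpoints may still oscillate on
   [g], hence the subsequence along which their values converge. *)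
pose g := e^-1 *: f; pose q n := mid (s (i n)) (s (j n)).
have [phi phik [l lP]] := @bounded_seq_cluster (fun n => q n g) `|g|
  (fun n => state_ler_norm _ _).
exists (q \o phi), g, (s \o i), (s \o j); split.
- by apply: finer_subseq => k; have [] := iP k.
- by apply: finer_subseq => k; have [] := iP k.
- move=> n /=; rewrite !stateZ -mulrBr mulrC ler_pdivlMr// mul1r.
  by have [_ _ /ltW] := iP n.
- exact: finer_subseq.
move=> d d0; have d20 : 0 < d / 2 by rewrite divr_gt0.
have [m mP] : exists m : nat, m.+1%:R^-1 <= d / 2.
  have := archi_boundP (ltW (_ : 0 < (d / 2)^-1)); rewrite invr_gt0 => /(_ d20) h.
  exists (Num.bound (d / 2)^-1); rewrite invf_ple ?posrE// (le_trans (ltW h))//.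
  by rewrite ler_nat.
have lm k : (m <= k)%N -> `|q (phi k) g - l| <= d / 2.
  move=> mk; rewrite (le_trans (lP k))// (le_trans _ mP)// lef_pV2 ?posrE//.
  by rewrite ler_nat.
exists m => a b /lm + /lm; rewrite !ler_norml /= => /andP[? ?] /andP[? ?]; lra.
Qed.

End finer_sequences.

(** * Descent along a maximal chain of refinements *)

Section maximal_chain.
Context {R : realType} {K : compactHausdorffType}.
Local Notation state := (state R K).
Implicit Types (s t u : nat -> state) (C : set (nat -> state)) (f g : Cspace K R).

Definition comparable s t := [\/ s = t, below s t | below t s].

Definition chain_under s0 C := (forall s, C s -> finer s s0) /\
  forall s t, C s -> C t -> comparable s t.

Lemma maximal_chain_under s0 : exists C, chain_under s0 C /\
  forall t, finer t s0 -> (forall s, C s -> comparable t s) -> C t.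
Proof.
have [F Fchain Ftot|C [Cchain Cmax]] := @Zorn_bigcup _ (chain_under s0).
  split=> [s [C FC]|s t [C FC Cs] [C' FC' Ct]]; first by have [+ _] := Fchain _ FC; exact.
  have [CC'|C'C] := Ftot _ _ FC FC'.
    by have [_] := Fchain _ FC'; apply=> //; exact: CC'.
  by have [_] := Fchain _ FC; apply=> //; exact: C'C.
exists C; split=> // t ts0 tC; apply: contrapT => Ct.
apply: (Cmax (C `|` [set t])).
  split; first by move=> s; left.
  by move=> /(_ t (or_intror erefl)).
have [Cs0 CC] := Cchain; split=> [s [/Cs0//|->//]|s u [Cs|->] [Cu|->]].
- exact: CC.
- by have [->|?|?] := tC _ Cs; [constructor 1|constructor 3|constructor 2].
- exact: tC.
- by constructor 1.
Qed.

Section no_stable_refinement.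
Variables (s0 : nat -> state) (C : set (nat -> state)).
Hypothesis unstable : forall t, finer t s0 -> exists f, ~ stable t f.
Hypotheses (Cchain : chain_under s0 C)
  (Cmax : forall t, finer t s0 -> (forall s, C s -> comparable t s) -> C t).

Lemma chain_lower_bound (a : nat -> nat -> state) k : (forall n, C (a n)) ->
  exists2 b, C b & forall j, (j <= k)%N -> finer b (a j).
Proof.
move=> Ca; elim: k => [|k [b Cb ba]].
  by exists (a 0%N) => // j; rewrite leqn0 => /eqP ->; exact: finer_refl.
have [ab|ab|ab] := Cchain.2 (a k.+1) b (Ca _) Cb.
- by exists b => // j; rewrite leq_eqVlt => /predU1P[->|/ba//]; rewrite ab; exact: finer_refl.
- exists (a k.+1) => // j; rewrite leq_eqVlt => /predU1P[->|/ba]; first exact: finer_refl.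
  exact: finer_trans (below_finer ab).
- by exists b => // j; rewrite leq_eqVlt => /predU1P[->|/ba//]; exact: below_finer.
Qed.

Lemma diagonal_state (a : nat -> nat -> state) k : (forall n, C (a n)) ->
  exists p, forall j, (j <= k)%N -> conv (tail (a j) k) p.
Proof.
move=> Ca; have [b _ ba] := chain_lower_bound k Ca.
suff [n0 n0P] : exists n0, forall n, (n0 <= n)%N ->
    forall j, (j <= k)%N -> conv (tail (a j) k) (b n).
  by exists (b n0); exact: n0P.
(* Induction on how many of the sequences are treated; the tail index stays [k]. *)
move: {1 3}k (leqnn k); elim=> [|i ih] ik.
  have [n0 n0P] := ba 0%N (leq0n k) k.
  by exists n0 => n /n0P bn j; rewrite leqn0 => /eqP ->.
have [n0 n0P] := ih (ltnW ik); have [n1 n1P] := ba i.+1 ik k.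
exists (maxn n0 n1) => n; rewrite geq_max => /andP[/n0P bn0 /n1P bn1] j.
by rewrite leq_eqVlt => /predU1P[->//|]; exact: bn0.
Qed.

(** Otherwise the [a n] are coinitial in [C]. A diagonal sequence [t] refines all of them, is
    unstable on some [f], and thus has a [t'] below it. Then [t'] is below all of [C], so maximality
    puts it into [C] and makes it lie below itself. *)
Lemma chain_strict_lower_bound (a : nat -> nat -> state) : (forall n, C (a n)) ->
  exists2 s, C s & forall n, below s (a n).
Proof.
move=> Ca; apply: contrapT => noLB.
have coinitial s : C s -> exists n, a n = s \/ below (a n) s.
  move=> Cs; apply: contrapT => /forallNP h; apply: noLB; exists s => // n.
  by have /not_orP[as_ bas] := h n; have [/esym//||//] := Cchain.2 s (a n) Cs (Ca n).
have [t tP] := choice (fun k => diagonal_state k Ca).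
have ta n : finer t (a n).
  move=> m; exists (maxn m n) => k; rewrite geq_max => /andP[mk nk].
  exact: (convS (@tailS _ _ (a n) _ _ mk)) (tP _ _ nk).
have ts0 := finer_trans (ta 0%N) (Cchain.1 _ (Ca 0%N)).
have [f tf] := unstable ts0; have [t' t't] := exists_below tf.
have t's s : C s -> below t' s.
  move=> /coinitial[n [<-|ans]]; first exact: below_finer_trans (ta n).
  apply: below_finer_trans t't _; exact: finer_trans (ta n) (below_finer ans).
apply: (@below_irrefl _ _ t'); apply: (t's); apply: Cmax.
  exact: finer_trans (below_finer t't) ts0.
by move=> s /t's; constructor 2.
Qed.

Lemma chain_nonempty : exists s, C s.
Proof.
apply: contrapT => /forallNP C0; apply: (C0 s0); apply: Cmax => [|s /C0//].
exact: finer_refl.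
Qed.

(** A chain is directed, so the hulls of the tails of its members form a filter base. An ultrafilter
    containing them takes the place of a limit along the chain. *)
Lemma chain_ultrafilter : exists U : set_system state, UltraFilter U /\
  forall s m, C s -> U (conv (tail s m)).
Proof.
have [s1 Cs1] := chain_nonempty.
pose F := filter_from [set sm : (nat -> state) * nat | C sm.1]
  (fun sm => conv (tail sm.1 sm.2)).
have sub s t m : finer s t -> exists n, forall k, (n <= k)%N ->
    conv (tail s k) `<=` conv (tail t m).
  move=> /(@finer_tail _ _ _ _ m)[n nP]; exists n => k nk.
  by apply: subset_trans nP; apply: convS; exact: tailS.
have PF : ProperFilter F.
  apply: filter_from_proper; last first.
    by move=> [s m] /= _; exists (s m); apply: conv_in; exists m => /=.
  apply: filter_from_filter; first by exists (s1, 0%N).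
  move=> [s m] [t n] /= Cs Ct.
  have [u [Cu us ut]] : exists u, [/\ C u, finer u s & finer u t].
    have [<-|st|ts] := Cchain.2 s t Cs Ct.
    - by exists s; split=> //; exact: finer_refl.
    - by exists s; split=> //; [exact: finer_refl|exact: below_finer].
    - by exists t; split=> //; [exact: below_finer|exact: finer_refl].
  have [k kP] := sub _ _ m us; have [l lP] := sub _ _ n ut.
  exists (u, maxn k l) => //= p up; split; first by apply: (kP _ (leq_maxl k l)).
  exact: (lP _ (leq_maxr k l)).
have [U [UU FU]] := ultraFilterLemma PF.
by exists U; split=> // s m Cs; apply: FU; exists (s, m).
Qed.

(** Weak* compactness of the set of states: the values at [f] stay in a compact interval, so they
    converge along [U], and the limits inherit linearity, positivity and normalization. *)
Lemma ultralimit_state (U : set_system state) : UltraFilter U ->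
  exists L : state, forall f, (fun p : state => p f) @ U --> L f.
Proof.
move=> UU.
have ex_lim (f : Cspace K R) : exists l : R, (fun p : state => p f) @ U --> l.
  have cM : compact [set` `[- `|f|, `|f|]] by exact: segment_compact.
  have Uf : ((fun p : state => p f) @ U) [set` `[- `|f|, `|f|]].
    apply: (@filterS _ U _ setT _ _ filterT) => p _ /=.
    rewrite in_itv /= -ler_norml; exact: state_ler_norm.
  have [l [_ lP]] := cM _ _ Uf; exists l => B lB.
  have [//|UnB] := in_ultra_setVsetC ((fun p : state => p f) @^-1` B) UU.
  by have [y []] := lP (~` B) B UnB lB.
have [L LP] := choice ex_lim.
have LD a f g : L (a *: f + g) = a * L f + L g.
  have := LP (a *: f + g); rewrite (_ : (fun p : state => _) = fun p => a * p f + p g).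
    by move=> /cvg_unique; apply; [exact: norm_hausdorff|apply: cvgD => //; exact: cvgMl_tmp].
  by apply/funext => p; rewrite stateP.
have Lge0 (f : Cspace K R) : (forall x, 0 <= f x) -> 0 <= L f.
  move=> f0; rewrite -(cvg_lim _ (LP f)); last exact: norm_hausdorff.
  apply: limr_ge; first by apply/cvg_ex; exists (L f).
  by apply: (@filterS _ U _ setT _ _ filterT) => p _; exact: state_ge0.
have L1 : L (Ccst 1) = 1.
  have := LP (Ccst 1); rewrite (_ : (fun p : state => _) = fun=> 1).
    by move=> /cvg_unique; apply; [exact: norm_hausdorff|exact: cvg_cst].
  by apply/funext => p; rewrite state1.
by exists (State LD Lge0 L1).
Qed.

End no_stable_refinement.

(** The index set is the chain [C]: every member [s] has a member [t] strictly below it, and [f] is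
    the function of that splitting. A lower bound of countably many such [t] is stable on their
    functions, and its own splitting gives a function far from all of them in the limit state. *)
Lemma unstable_nonseparable s0 : (forall t, finer t s0 -> exists f, ~ stable t f) ->
  exists (L : state) (I : Type) (_ : I) (f : I -> Cspace K R),
    forall a : nat -> I, exists i, forall n, 1 / 4 <= L (Cabs (f i - f (a n))).
Proof.
move=> unstable; have [C [Cchain Cmax]] := maximal_chain_under s0.
have [U [UU UC]] := chain_ultrafilter Cchain Cmax.
have [L LU] := ultralimit_state UU.
have [s1 Cs1] := chain_nonempty Cmax.
have lower := chain_strict_lower_bound unstable Cchain Cmax.
have ex_next (s : {s | C s}) :
    exists tf : (nat -> state) * Cspace K R, C tf.1 /\ splits tf.1 (sval s) tf.2.
  have [t Ct /(_ 0%N)[f tsf]] := lower (fun=> sval s) (fun=> svalP s).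
  by exists (t, f).
have [next nextP] := choice ex_next.
exists L, {s | C s}, (exist _ s1 Cs1), (fun i => (next i).2) => a.
(* The bound is taken below the members [(next (a n)).1], not just below the [a n], because the
   former are stable on the functions of index [a n]. *)
have [|s Cs sa] := lower (fun n => (next (a n)).1).
  by move=> n; have [] := nextP (a n).
exists (exist _ s Cs) => n; have [Ct tsf] := nextP (exist _ s Cs).
have sf : stable s (next (a n)).2.
  have [_ [? [? [_ _ _ _ nf]]]] := nextP (a n).
  exact: stable_finer (below_finer (sa n)) nf.
have [m mP] := splits_far tsf sf.
rewrite -(cvg_lim _ (LU _)); last exact: norm_hausdorff.
apply: limr_ge; first by apply/cvg_ex; exists (L (Cabs ((next (exist _ s Cs)).2 - (next (a n)).2))).
apply: (@filterS _ U _ _ _ _ (UC _ m Ct)) => p; exact: mP.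
Qed.

End maximal_chain.

(** * Convergent averages in the class (MS) *)

Section class_MS_refinement.
Context {R : realType} {K : compactHausdorffType}.
Implicit Type f : Cspace K R.

Section L1_approximation.
Context (x0 : K) (mu : probability (borel x0) R).

Let measurable_abs (h : borel x0 -> R) : measurable_fun [set: borel x0] h ->
  measurable_fun [set: borel x0] (fun x => `|(h x)%:E|%E).
Proof. by move=> mh; apply: measurableT_comp => //; exact/measurable_EFinP. Qed.

Let measurable_aeEqMfun (g : {mfun_ mu, borel x0 >-> measurableTypeR R}) :
  measurable_fun [set: borel x0] (g : borel x0 -> R).
Proof. exact: (@measurable_funPT _ _ _ _ (repr g)). Qed.

(** A member of [LspaceType1 mu] is a class, and its representative equals [f] only almost
    everywhere. Boundedness of [f] and the mass 1 of [mu] give integrability. *)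
Lemma Cspace_Lspace1 f : exists F : LspaceType1 mu, (F : borel x0 -> R) = f %[ae mu].
Proof.
have mf : (f : borel x0 -> R) \in (@mfun _ _ (borel x0) (measurableTypeR R)).
  by rewrite inE /=; exact: measurable_Cspace_borel.
pose f' : {mfun borel x0 >-> measurableTypeR R} :=
  @mfun_Sub _ _ (borel x0) (measurableTypeR R) f mf.
pose g : {mfun_ mu, borel x0 >-> measurableTypeR R} := (\pi f')%qT.
have gf : (g : borel x0 -> R) = f' %[ae mu].
  by have /eqmodP/asboolP := reprK g.
have mg := measurable_aeEqMfun g.
have fing : finite_norm mu 1 g.
  rewrite /finite_norm Lnorm1.
  rewrite (@ge0_ae_eq_integral _ _ _ mu _ _ (fun x => `|(f x)%:E|%E))//; last 3 first.
  - exact: measurable_abs.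
  - by apply: measurable_abs; exact: measurable_Cspace_borel.
  - by move: gf; apply: filterS => x h /h /= ->.
  apply: (@le_lt_trans _ _ (\int[mu]_x (cst (`|f|%:E) x))%E).
    apply: ge0_le_integral => //.
    - by apply: measurable_abs; exact: measurable_Cspace_borel.
    - by move=> x _; rewrite lee_fin; exact: Cspace_le_norm.
  rewrite integral_cst// [X in (_ * X)%E](_ : _ = 1%E) ?mule1 ?ltry//.
  exact: probability_setT.
pose G : LspaceType1 mu := HB.pack g (isFinLebesgue.Build _ _ _ _ _ _ _ fing).
by exists G.
Qed.

(** Each [g] in the countable dense [D] that is [e / 2]-close to some [f j] chooses one such index,
    stored under the code of [g]. Then every [f i] shares an approximant with a chosen function. *)
Lemma separable_L1_no_far_family (I : Type) (i0 : I) (f : I -> Cspace K R) (e : R) :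
  separable_L1 mu -> 0 < e ->
  exists a : nat -> I, forall i, exists n,
    (\int[mu]_x `|f i x - f (a n) x|%:E < e%:E)%E.
Proof.
move=> [D [/pcard_injP[code code_inj] Ddense]] e0.
have e20 : 0 < e / 2 by rewrite divr_gt0.
pose close i (g : LspaceType1 mu) := (\int[mu]_x `|f i x - g x|%:E < (e / 2)%:E)%E.
have mfg i (g : LspaceType1 mu) :
    measurable_fun [set: borel x0] (fun x : borel x0 => `|f i x - g x|%:E).
  apply: measurable_abs; apply: measurable_funB; first exact: measurable_Cspace_borel.
  exact: measurable_aeEqMfun.
have exclose i : exists2 g, D g & close i g.
  have [F Ff] := Cspace_Lspace1 (f i).
  have [g Dg] := Ddense F _ e20; rewrite Lnorm1 => Fg; exists g => //.
  apply: le_lt_trans Fg; rewrite le_eqVlt; apply/orP; left; apply/eqP.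
  apply: ge0_ae_eq_integral => //.
    by apply: measurable_abs; apply: measurable_funB; exact: measurable_aeEqMfun.
  by move: Ff; apply: filterS => x h /h /= ->.
have ex_a n : exists i, (exists g j, [/\ D g, code g = n & close j g]) ->
    exists g, [/\ D g, code g = n & close i g].
  have [[g [i h]]|nh] := pselect (exists g j, [/\ D g, code g = n & close j g]).
    by exists i => _; exists g.
  (* [i0] fills the codes that belong to no suitable [g]. *)
  by exists i0 => /nh.
have [a aP] := choice ex_a; exists a => i.
have [g Dg ig] := exclose i; exists (code g).
have [|g' [Dg' g'g]] := aP (code g); first by exists g, i.
have {g'g}-> : g' = g by apply: code_inj g'g; rewrite inE.
move=> ag; rewrite (splitr e) EFinD; apply: le_lt_trans (lteD ig ag).
rewrite -ge0_integralD//.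
apply: ge0_le_integral => //.
- apply: measurable_abs; apply: measurable_funB; exact: measurable_Cspace_borel.
- exact: emeasurable_funD.
move=> x _; rewrite -EFinD lee_fin.
by rewrite [X in _ <= _ + X]distrC (le_trans _ (ler_normD _ _))// addrA subrK.
Qed.

End L1_approximation.

Theorem class_MS_stable_refinement (s : nat -> state R K) : class_MS R K ->
  exists2 t, finer t s & forall f, stable t f.
Proof.
move=> MS; apply: contrapT => /forall2NP h.
have [|L [I [i0 [f far]]]] := @unstable_nonseparable _ _ s.
  by move=> t ts; have [//|/existsNP] := h t.
(* The state [L] forces [K] to be nonempty: on an empty space the constant 1 equals 0. *)
have [x0 _] : exists x0 : K, True.
  apply: contrapT => noK; have := state1 L.
  rewrite (_ : Ccst 1 = 0) ?state0; first by move/eqP; rewrite eq_sym oner_eq0.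
  by apply: CspaceP => x; case: noK; exists x.
have sep := MS x0 _ (@representing_measure_radon _ _ L x0).
have e : 0 < 1 / 4 :> R by lra.
have [a aP] := separable_L1_no_far_family i0 f sep e.
have [i iP] := far a; have [n] := aP i; apply/negP; rewrite -leNgt.
apply: (@le_trans _ _ (L (Cabs (f i - f (a n))))%:E); first by rewrite lee_fin; exact: iP.
apply: state_le_integral => x; exact: normr_ge0.
Qed.

End class_MS_refinement.

(** * Operators on [c0] *)

Lemma cauchy_real_seq (R : realType) (u : nat -> R) :
  (forall e, 0 < e -> exists m, forall i j, (m <= i)%N -> (m <= j)%N -> u i - u j <= e) ->
  exists l : R, u @ \oo --> l.
Proof.
move=> uC; apply/cvg_ex; apply: cauchy_cvg; apply: cauchy_exP => e e0.
have [m mP] := uC (e / 2) (divr_gt0 e0 (ltr0Sn _ _)).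
exists (u m); exists m => // n /= mn; rewrite /ball /= ltr_norml.
have := mP m n (leqnn m) mn; have := mP n m mn (leqnn m); lra.
Qed.

Section null_sequences.
Context {R : realType}.
Implicit Types (u v : c0 R).

Definition null_seq (u : nat -> R) := forall e, 0 < e ->
  exists N, forall n, (N <= n)%N -> `|u n| <= e.

Lemma null_seq_cvg (u : nat -> R) : null_seq u -> u @ \oo --> (0 : R).
Proof.
move=> u0; apply/cvgr0Pnorm_le => e /u0[N NP].
by exists N => // n /=; exact: NP.
Qed.

Lemma cvg_null_seq (u : nat -> R) : u @ \oo --> (0 : R) -> null_seq u.
Proof. by move=> /cvgr0Pnorm_le h e /h[N _ NP]; exists N => n; exact: NP. Qed.

Definition c0_of (u : nat -> R) (u0 : null_seq u) : c0 R := MkC0 (mem_set (null_seq_cvg u0)).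

Lemma c0_null u : null_seq u. Proof. exact: cvg_null_seq (@c0_cvg R u). Qed.

Lemma c0P u v : u =1 v -> u = v.
Proof. by move=> uv; apply/val_inj/funext. Qed.

Lemma c0_addE u v n : (u + v) n = u n + v n. Proof. by []. Qed.
Lemma c0_oppE u n : (- u) n = - u n. Proof. by []. Qed.
Lemma c0_scaleE a u n : (a *: u) n = a * u n. Proof. by []. Qed.
Lemma c0_zeroE n : (0 : c0 R) n = 0. Proof. by []. Qed.
Definition c0E := (c0_addE, c0_oppE, c0_scaleE, c0_zeroE).

Lemma c0_le_norm u n : `|u n| <= `|u|.
Proof. exact: le_supnorm (c0_bounded u). Qed.

Lemma c0_norm_le u M : 0 <= M -> (forall n, `|u n| <= M) -> `|u| <= M.
Proof. exact: supnorm_le. Qed.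

(** The limit is taken coordinatewise and keeps the modulus [b], which gives the rate used for the
    Neumann series. *)
Lemma c0_complete (w : nat -> c0 R) (b : nat -> R) :
  (forall m n, (m <= n)%N -> `|w n - w m| <= b m) -> null_seq b ->
  exists v, forall n, `|v - w n| <= b n.
Proof.
move=> wb b0.
have wbk m n k : (m <= n)%N -> `|w n k - w m k| <= b m.
  by move=> mn; apply: le_trans (wb _ _ mn); exact: (c0_le_norm (w n - w m)).
have ex_l k : exists l : R, (fun n => w n k) @ \oo --> l.
  apply: cauchy_real_seq => e e0; have [N NP] := b0 (e / 2) (divr_gt0 e0 (ltr0Sn _ _)).
  exists N => i j /wbk Ni /wbk Nj; have := NP N (leqnn N); have := Ni k; have := Nj k.
  rewrite !ler_norml => /andP[? ?] /andP[? ?] /andP[? ?]; lra.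
have [v vP] := choice ex_l.
have vw k n : `|v k - w n k| <= b n.
  have cv : (fun m => `|w m k - w n k|) @ \oo --> `|v k - w n k|.
    by apply: cvg_norm; apply: cvgB; [exact: vP|exact: cvg_cst].
  rewrite -(cvg_lim _ cv)//; apply: limr_le; first by apply/cvg_ex; exists `|v k - w n k|.
  by exists n => // m /= nm; exact: wbk.
have v0 : null_seq v.
  move=> e e0; have e20 : 0 < e / 2 by rewrite divr_gt0.
  have [N NP] := b0 _ e20; have [M MP] := c0_null (w N) e20.
  exists M => k /MP wk; have := NP N (leqnn N); have := vw k N; move: wk.
  rewrite !ler_norml => /andP[? ?] /andP[? ?] /andP[? ?]; apply/andP; split; lra.
exists (c0_of v0) => n; apply: c0_norm_le => [|k]; last exact: vw.
by apply: le_trans (vw 0%N n).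
Qed.

Lemma null_seq_geometric (C : R) : null_seq (fun n => C / 2 ^+ n).
Proof.
apply: cvg_null_seq; rewrite -(mulr0 C); apply: cvgMl_tmp.
under eq_fun do rewrite -exprVn; apply: cvg_expr.
by rewrite ger0_norm ?invf_lt1 ?invr_ge0// ltr1n.
Qed.

Lemma near_identity_invertible (A : {linear c0 R -> c0 R}) :
  (forall u, `|A u - u| <= `|u| / 2) ->
  exists B : {linear c0 R -> c0 R},
    [/\ cancel A B, cancel B A & forall u, `|B u| <= 2 * `|u|].
Proof.
move=> A2.
have low u : `|u| <= 2 * `|A u|.
  have := A2 u; have := ler_distD (A u) u 0; rewrite !subr0 [`|u - _|]distrC; lra.
have inj : injective A.
  move=> u v Auv; apply/eqP; rewrite -subr_eq0 -normr_le0.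
  by apply: le_trans (low _) _; rewrite linearB /= Auv subrr normr0 mulr0.
have ex_inv u : exists v, A v = u.
  (* The Neumann series: [r n] is the [n]-th power of [1 - A] at [u], and the partial sum [w n]
     solves the equation up to [r n]. *)
  pose r := fix r n := if n is m.+1 then r m - A (r m) else u.
  pose w n := \sum_(i < n) r i.
  have rn n : `|r n| <= `|u| / 2 ^+ n.
    elim: n => [|n ih]; first by rewrite expr0 divr1.
    rewrite /= distrC (le_trans (A2 _))// exprSr invfM mulrA.
    by rewrite ler_pM2r ?invr_gt0.
  have Aw n : A (w n) = u - r n.
    elim: n => [|n ih]; first by rewrite /w big_ord0 linear0 subrr.
    by rewrite /w big_ord_recr linearD /= -/(w n) ih opprB [A _ - _]addrC addrA.
  have ww m d : `|w (m + d)%N - w m| <= 2 * `|u| / 2 ^+ m - 2 * `|u| / 2 ^+ (m + d).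
    elim: d => [|d ih]; first by rewrite addn0 !subrr normr0.
    rewrite addnS /w big_ord_recr /= -/(w _) addrAC (le_trans (ler_normD _ _))//.
    apply: le_trans (lerD ih (rn _)) _.
    by rewrite exprSr invfM [X in _ <= _ - X]mulrA [2 * _]mulrC -!mulrA; lra.
  have [m n mn||v vP] := @c0_complete w (fun n => 2 * `|u| / 2 ^+ n).
  - by rewrite -(subnKC mn) (le_trans (ww _ _))// gerBl divr_ge0 ?mulr_ge0.
  - exact: null_seq_geometric.
  exists v; apply/eqP; rewrite -subr_eq0 -normr_le0; apply/ler_addgt0Pr => e e0.
  have A_le z : `|A z| <= 2 * `|z|.
    have := A2 z; have := ler_distD z (A z) 0; rewrite !subr0.
    by have := normr_ge0 z; lra.
  (* The factor 5 is 4 + 1: [A] has norm at most 2 and acts on a vector of norm at most twice the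
     [N]-th geometric term; [r N] adds one more such term. *)
  have [N NP] := null_seq_geometric (5 * `|u|) e0.
  have -> : A v - u = A (v - w N) - r N by rewrite linearB /= Aw opprB addrA addrAC addrK.
  rewrite add0r (le_trans (ler_normB _ _))//.
  have := NP N (leqnn N); have := A_le (v - w N); have := vP N; have := rn N.
  rewrite [X in X <= e]ger0_norm; last by rewrite divr_ge0 ?mulr_ge0// exprn_ge0.
  set q := `|u| / _; rewrite -!mulrA -/q; lra.
have [B BP] := choice ex_inv.
have Blin : linear B by move=> a u v; apply: inj; rewrite linearP /= !BP.
pose Bm := GRing.isLinear.Build _ _ _ _ _ Blin.
pose Bl : {linear c0 R -> c0 R} := HB.pack B Bm.
exists Bl; split=> [u|u|u]; [by apply: inj; rewrite /= BP|exact: BP|].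
by apply: le_trans (low _) _; rewrite /= BP.
Qed.

End null_sequences.

Section complemented_range.
Context {R : realType} {V : normedModType R}.
Implicit Types (J : {linear c0 R -> V}) (S : {linear V -> c0 R}).

Lemma bounded_operator_continuous (W1 W2 : normedModType R) (A : {linear W1 -> W2}) :
  bounded_operator A -> continuous A.
Proof.
move=> [M AM]; apply: bounded_linear_continuous; apply/linear_boundedP.
near=> r => x; apply: le_trans (AM x) _; by rewrite ler_wpM2r.
Unshelve. all: by end_near. Qed.

(** With [B] inverse to [S \o J], the composition of [S], [B] and [J] is a projection [P] onto the
    range of [J]. The range is closed as the zero set of [P - 1], and [B \o S] inverts [J] on it. *)
Lemma complemented_range J S : bounded_operator J -> bounded_operator S ->
  (forall u, `|S (J u) - u| <= `|u| / 2) ->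
  [/\ closed_subspace (range J), isomorphic_to (c0 R) (range J) &
      complemented (range J)].
Proof.
move=> [M JM] [N SN] SJ.
have [B [BK KB B2]] := @near_identity_invertible R (S \o J) SJ.
pose P : {linear V -> V} := J \o (B \o S).
have PJ u : P (J u) = J u by rewrite /P /=; congr (J _); exact: BK.
have BS x : `|B (S x)| <= 2 * `|N| * `|x|.
  rewrite (le_trans (B2 _))// -mulrA ler_pM2l// (le_trans (SN x))//.
  by rewrite ler_wpM2r// ler_norm.
have Pbd : bounded_operator P.
  exists (`|M| * (2 * `|N|)) => x; rewrite /P /= (le_trans (JM _))//.
  rewrite -mulrA; apply: le_trans (ler_wpM2l (normr_ge0 M) (BS x)).
  by rewrite ler_wpM2r// ler_norm.
have rangeP : range J = [set x | P x - x = 0].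
  apply/seteqP; split=> [_ [u _ <-]|x /= /eqP].
    by apply/eqP; rewrite subr_eq0; apply/eqP; exact: PJ.
  by rewrite subr_eq0 => /eqP <-; exists (B (S x)).
have clJ : closed (range J).
  rewrite rangeP; apply: (@closed_comp _ _ (fun x => P x - x) [set 0]); last first.
    by apply: accessible_closed_set1; apply: hausdorff_accessible; exact: norm_hausdorff.
  move=> x _; apply: cvgB; last exact: cvg_id.
  exact: bounded_operator_continuous.
split.
- split=> //; first by exists 0 => //; rewrite linear0.
  by move=> a _ _ [u _ <-] [v _ <-]; exists (a *: u + v) => //; rewrite linearP.
- exists J; split=> //; split=> //; first by exists M.
  by exists (B \o S); split; [exact: BK|exists (2 * `|N|) => x _; exact: BS].
- exists P; split=> // [x|]; first by rewrite /P /=; congr (J _); exact: BK.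
  apply/seteqP; split=> [_ [x _ <-]|_ [u _ <-]]; first by exists (B (S x)).
  by exists (J u).
Qed.

End complemented_range.

(** * Images of the unit vectors under an operator *)

Section operators_on_c0.
Context {R : realType} {K : compactHausdorffType}.

Lemma c0unit_null n : null_seq (fun k => (k == n)%:R : R).
Proof.
move=> e e0; exists n.+1 => k nk; rewrite (_ : (k == n) = false) ?normr0 ?ltW//.
by apply/negbTE; rewrite neq_ltn nk orbT.
Qed.
Definition c0unit n : c0 R := c0_of (c0unit_null n).

Lemma c0trunc_null (u : nat -> R) N : null_seq (fun k => if (k < N)%N then u k else 0).
Proof. by move=> e e0; exists N => k Nk; rewrite ltnNge Nk /= normr0 ltW. Qed.
(** The sequence [u] need not be null; sign sequences are truncated too. *)
Definition c0trunc u N : c0 R := c0_of (@c0trunc_null u N).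

Lemma c0unit_norm_ge1 n : 1 <= `|c0unit n|.
Proof. by have := c0_le_norm (c0unit n) n; rewrite /= eqxx normr1. Qed.

Section bounded_operator.
Context (T : {linear c0 R -> Cspace K R}) (M : R).
Hypotheses (M0 : 0 < M) (TM : forall u, `|T u| <= M * `|u|).
Local Notation f n := (T (c0unit n)).

Lemma operator_trunc (u : nat -> R) N x :
  T (c0trunc u N) x = \sum_(n < N) u n * f n x.
Proof.
elim: N => [|N ih].
  by rewrite big_ord0 (_ : c0trunc u 0 = 0) ?linear0//; exact: c0P.
rewrite big_ord_recr /= -ih (_ : c0trunc u N.+1 = u N *: c0unit N + c0trunc u N).
  by rewrite linearP CspaceE CspaceE addrC.
apply: c0P => n; rewrite !c0E /= ltnS leq_eqVlt.
by case: eqVneq => [->|_]; rewrite ?ltnn ?mulr1 ?addr0 ?mulr0 ?add0r.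
Qed.

(** Truncations converge to [u] in norm and [T] is bounded, so estimates on partial sums pass to
    [T u]. *)
Lemma operator_eval_le (u : c0 R) x (B : R) :
  (forall N, `|\sum_(n < N) u n * f n x| <= B) -> `|T u x| <= B.
Proof.
move=> uB; apply/ler_addgt0Pr => e e0.
have [N NP] := c0_null u (divr_gt0 e0 M0).
have uN : `|u - c0trunc u N| <= e / M.
  apply: c0_norm_le => [|n]; first by rewrite ltW// divr_gt0.
  rewrite !c0E /=; case: ltnP => [_|/NP]; last by rewrite subr0.
  by rewrite subrr normr0 ltW// divr_gt0.
have -> : T u x = T (c0trunc u N) x + T (u - c0trunc u N) x.
  by rewrite linearB !CspaceE addrC subrK.
rewrite (le_trans (ler_normD _ _))// lerD ?operator_trunc//.
rewrite (le_trans (Cspace_le_norm _ _))// (le_trans (TM _))//.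
by rewrite mulrC -ler_pdivlMr.
Qed.

(** The truncated sequence of the signs of [f n x] has norm at most 1, and the value of its image at
    [x] is the sum. *)
Lemma sum_norm_units_le x N : \sum_(n < N) `|f n x| <= M.
Proof.
pose s n := Num.sg (f n x).
have s1 : `|c0trunc s N| <= 1.
  apply: c0_norm_le => // n /=; case: ifP => _; last by rewrite normr0.
  by rewrite normr_sg; case: (_ != _).
rewrite (eq_bigr (fun n : 'I_N => s n * f n x)); last by move=> n _; rewrite -normrEsg.
rewrite -operator_trunc (le_trans (ler_norm _))// (le_trans (Cspace_le_norm _ _))//.
by rewrite (le_trans (TM _))// ler_piMr// ltW.
Qed.

Lemma units_null x : null_seq (fun n => f n x).
Proof.
apply: cvg_null_seq; apply/cvgr0Pnorm_lt => e e0.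
have cvS : cvgn (series (fun n => `|f n x|)).
  apply: nondecreasing_is_cvgn.
    apply/nondecreasing_seqP => n; rewrite seriesEnat /= big_nat_recr//= lerDl//.
  by exists M => _ [n _ <-]; rewrite seriesEord; exact: sum_norm_units_le.
have /cvgr0Pnorm_lt/(_ e e0) := cvg_series_cvg_0 cvS.
by apply: filterS => n; rewrite normr_id.
Qed.

End bounded_operator.
End operators_on_c0.

(** * Gliding hump *)

Section gliding_hump.
Context {R : realType} {K : compactHausdorffType}.
Context (f : nat -> Cspace K R) (x : nat -> K).
Hypothesis f0 : forall y, null_seq (fun n => f n y).

Lemma eventually_small (n : nat) (e : R) : 0 < e ->
  exists N, forall k, (N <= k)%N -> forall m, (m <= n)%N -> `|f k (x m)| <= e.
Proof.
move=> e0; elim: n => [|n [N NP]].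
  have [N NP] := f0 (x 0%N) e0.
  by exists N => k /NP ? m; rewrite leqn0 => /eqP ->.
have [N' NP'] := f0 (x n.+1) e0; exists (maxn N N') => k; rewrite geq_max.
by move=> /andP[/NP ? /NP' ?] m; rewrite leq_eqVlt => /predU1P[->//|]; auto.
Qed.

Lemma small_nbhs (y : K) (n : nat) (e : R) : `|f n y| < e ->
  nbhs y [set z | `|f n z| < e].
Proof.
move=> ye; apply: open_nbhs_nbhs; split=> //.
rewrite (_ : [set _ | _] = [set z | - e < (- Cabs (f n)) z]); first exact: Cspace_open_gt.
by apply/seteqP; split=> z; rewrite /= ltrN2.
Qed.

(** Let [y] be a cluster point of [x]. Each new index is chosen so that its function is small at [y]
    and at all earlier points, which settles [i < j], and its point lies in a neighbourhood of [y]
    where all functions chosen before are small, which settles [j < i]. *)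
Lemma almost_disjoint_subsequence (d : nat -> R) : (forall n, 0 < d n) ->
  exists phi : nat -> nat, {homo phi : i j / (i < j)%N} /\
    forall i j, i != j -> `|f (phi j) (x (phi i))| <= d j.
Proof.
move=> d0.
have [|y [_ yc]] := @compact_setT K (x @ \oo) _; first exact: filterT.
have ex_next (p : nat * (nat * set K)) : exists n', nbhs y p.2.2 ->
    [/\ (p.2.1 < n')%N, p.2.2 (x n'), `|f n' y| < d p.1 &
      forall m, (m <= p.2.1)%N -> `|f n' (x m)| <= d p.1].
  case: p => j [n V] /=; have [yV|] := pselect (nbhs y V); last by exists 0%N.
  have [N NP] := eventually_small n (d0 j).
  (* Halving makes the inequality at [y] strict, so that it persists in a neighbourhood of [y]. *)
  have [N' NP'] := f0 y (divr_gt0 (d0 j) (ltr0Sn _ 1)).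
  pose L := maxn n.+1 (maxn N N').
  have [|_ [[k + <-] Vk]] := yc (x @` [set k | (L <= k)%N]) V _ yV.
    by exists L => // k /= Lk; exists k.
  rewrite /= !geq_max => /and3P[nk Nk N'k]; exists k => _; split=> //; last exact: NP.
  by apply: le_lt_trans (NP' _ N'k) _; rewrite ltr_pdivrMr// ltr_pMr// ltr1n.
have [next nextP] := choice ex_next.
(* [st j] holds the last chosen index and the current neighbourhood. The initial index 0 is a
   placeholder, so [phi j] is read off at [j.+1]. *)
pose st := fix st j : nat * set K := if j is i.+1 then
  let n := next (i, st i) in (n, (st i).2 `&` [set z | `|f n z| < d i]) else (0%N, setT).
have stV j : nbhs y (st j).2.
  elim: j => [|j ih] /=; first exact: filterT.
  by apply: filterI => //; apply: small_nbhs; have [] := nextP (j, st j) ih.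
pose phi j := (st j.+1).1.
have phiP j := nextP (j, st j) (stV j).
have phi_mono : {homo phi : i j / (i < j)%N}.
  by apply: homo_ltn => [|i]; [exact: ltn_trans|have [] := phiP i.+1].
have stS i k : (st (i + k)%N).2 `<=` (st i).2.
  by elim: k => [|k ih]; rewrite ?addn0// addnS => z /= [/ih].
exists phi; split=> // i j; rewrite neq_ltn => /orP[ij|ji].
  have [_ _ _] := phiP j; apply.
  case: j ij => // j; rewrite ltnS leq_eqVlt => /predU1P[->//|/phi_mono/ltnW].
  exact.
have [_ /= xV _ _] := phiP i.
have : (st j.+1).2 (x (phi i)) by rewrite -(subnKC ji) in xV *; exact: stS xV.
by move=> [_ /ltW].
Qed.

Lemma separated_subsequence (e : R) : 0 < e ->
  exists phi : nat -> nat, {homo phi : i j / (i < j)%N} /\ forall i N,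
    \sum_(n < N | `[< exists j, phi j = n >] && (n != phi i :> nat)) `|f n (x (phi i))| <= e.
Proof.
move=> e0.
have [|phi [phi_mono phiP]] := almost_disjoint_subsequence (d := fun j => e / 2 ^+ j.+1).
  by move=> j; rewrite divr_gt0// exprn_gt0.
exists phi; split=> // i N.
pose A n := `[< exists j, phi j = n >].
(* [rank n] counts the chosen indices below [n]. As [rank (phi j) <= j], the tolerances are
   dominated by a geometric sum that runs over [n] itself. *)
pose rank := fix rank n := if n is m.+1 then (rank m + A m)%N else 0%N.
have rank_phi n j : (n <= phi j)%N -> (rank n <= j)%N.
  elim: n j => [//|n ih] j nj /=; rewrite /A; case: asboolP => [[k kn]|_].
    rewrite addn1; have kj : (k < j)%N.
      rewrite ltnNge; apply/negP => jk; move: nj; rewrite -kn ltnNge.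
      by have [->|jk'] := eqVneq j k; rewrite ?leqnn// ltnW// phi_mono// ltn_neqAle jk' jk.
    by apply: leq_ltn_trans kj; apply: ih; rewrite kn.
  by rewrite addn0; apply: ih; exact: ltnW.
suff : \sum_(n < N | A n) e / 2 ^+ (rank n).+1 <= e.
  apply: le_trans; rewrite big_mkcondr /=; apply: ler_sum => n.
  move=> /asboolP[j jn]; case: ifPn => [nphi|_]; last by rewrite divr_ge0 ?ltW ?exprn_gt0.
  have ij : i != j by apply: contra nphi => /eqP ->; rewrite jn.
  rewrite -jn (le_trans (phiP _ _ ij))// ler_pM2l// lef_pV2 ?posrE ?exprn_gt0//.
  by rewrite ler_eXn2l ?ltr1n// ltnS; exact: rank_phi.
(* The subtracted term is the unspent rest of the geometric series; it carries the induction. *)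
suff : \sum_(n < N | A n) e / 2 ^+ (rank n).+1 <= e - e / 2 ^+ rank N.
  by move=> /le_trans; apply; rewrite gerBl divr_ge0 ?ltW ?exprn_gt0.
elim: N => [|N ih]; first by rewrite big_ord0 expr0 divr1 subrr.
rewrite big_mkcond big_ord_recr /= -big_mkcond /=.
case: (A N); rewrite ?addn0 ?addr0// addn1.
apply: le_trans (lerD ih (lexx _)) _.
by rewrite !exprS invfM; set q := (_ ^+ _)^-1; lra.
Qed.

End gliding_hump.

(** * Averages over consecutive blocks *)

Section disjoint_blocks.
Context {R : realType} {K : compactHausdorffType}.
Local Notation state := (state R K).
Implicit Types (s t : nat -> state) (p : state).

Definition block s m n := [set s i | i in [set i | (m <= i < n)%N]].

Lemma conv_tail_block s m p : conv (tail s m) p ->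
  exists2 n, (m < n)%N & conv (block s m n) p.
Proof.
have blockS n n' : (n <= n')%N -> conv (block s m n) `<=` conv (block s m n').
  move=> nn'; apply: convS => _ [i /andP[mi ni] <-]; exists i => //=.
  by rewrite mi (leq_trans ni).
elim=> [_ [i mi <-]|c q r r' c01 _ [n mn nq] _ [n' _ n'r] r'E].
  by exists i.+1 => //; apply: conv_in; exists i => //=; rewrite mi ltnSn.
exists (maxn n n'); first by rewrite leq_max mn.
apply: (conv_mix c01 _ _ r'E); first exact: blockS (leq_maxl _ _) _ nq.
exact: blockS (leq_maxr _ _) _ n'r.
Qed.

Lemma finer_blocks t s : finer t s -> exists tau a : nat -> nat,
  [/\ forall k, (k <= tau k)%N, {homo a : k l / (k < l)%N} &
      forall k, conv (block s (a k) (a k.+1)) (t (tau k))].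
Proof.
move=> ts.
have ex_block (km : nat * nat) : exists jn : nat * nat,
    [/\ (km.1 <= jn.1)%N, (km.2 < jn.2)%N & conv (block s km.2 jn.2) (t jn.1)].
  case: km => k m; have [k0 k0P] := ts m.
  have [n mn np] := conv_tail_block (k0P _ (leq_maxl k0 k)).
  by exists (maxn k0 k, n); split=> //=; exact: leq_maxr.
have [F FP] := choice ex_block.
pose a := fix a k := if k is l.+1 then (F (l, a l)).2 else 0%N.
exists (fun k => (F (k, a k)).1), a; split=> [k||k].
- by have [] := FP (k, a k).
- by apply: homo_ltn => [|k]; [exact: ltn_trans|have [] := FP (k, a k)].
- by have [] := FP (k, a k).
Qed.

Lemma eval_stateP (x : K) a (f g : Cspace K R) : (a *: f + g) x = a * f x + g x.
Proof. by []. Qed.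
Definition eval_state (x : K) : state := @State R K (fun f => f x)
  (@eval_stateP x) (fun f f0 => f0 x) erefl.

End disjoint_blocks.

Section spreading_operator.
Context {R : realType} (psi : nat -> option nat) (sigma : nat -> R).
Hypothesis psi_infty :
  forall l, exists N, forall n k, (N <= n)%N -> psi n = Some k -> (l <= k)%N.
Hypothesis sigma1 : forall n, `|sigma n| <= 1.

(** The [k]-th unit vector goes to the sum of [sigma n] times the [n]-th one over all [n] with
    [psi n = Some k]. By [psi_infty] these sums are finite and null sequences stay null. *)
Definition spread_fun (u : nat -> R) n := if psi n is Some k then sigma n * u k else 0.

Lemma spread_null (u : c0 R) : null_seq (spread_fun u).
Proof.
move=> e e0; have [l lP] := c0_null u e0; have [N NP] := psi_infty l.
exists N => n Nn; rewrite /spread_fun; case psin : (psi n) => [k|]; last by rewrite normr0 ltW.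
by rewrite normrM (le_trans (ler_piMl _ _))// lP// (NP n).
Qed.

Definition spread_c0 (u : c0 R) := c0_of (@spread_null u).

Lemma spread_linear : linear spread_c0.
Proof.
move=> a u v; apply: c0P => n; rewrite !c0E /= /spread_fun.
by case: (psi n) => [k|]; [rewrite mulrDr mulrCA|rewrite mulr0 addr0].
Qed.
HB.instance Definition _ := GRing.isLinear.Build R (c0 R) (c0 R) _ spread_c0 spread_linear.

Lemma spread_norm_le u : `|spread_c0 u| <= `|u|.
Proof.
apply: c0_norm_le => // n; rewrite /= /spread_fun.
case: (psi n) => [k|]; last by rewrite normr0.
by rewrite normrM (le_trans (ler_piMl _ _))// c0_le_norm.
Qed.

End spreading_operator.

Section functional_operator.
Context {R : realType} {K : compactHausdorffType}.
Context (nu : nat -> Cspace K R -> R) (M : R).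
Hypotheses (nuP : forall n a f g, nu n (a *: f + g) = a * nu n f + nu n g)
  (nu_null : forall f, null_seq (fun n => nu n f))
  (M0 : 0 <= M) (nuM : forall n f, `|nu n f| <= M * `|f|).

(** A bounded weak*-null sequence of functionals seen as an operator into [c0]. *)
Definition functionals_c0 (f : Cspace K R) := c0_of (nu_null f).

Lemma functionals_linear : linear functionals_c0.
Proof. by move=> a f g; apply: c0P => n; rewrite !c0E /= nuP. Qed.
Let functionals_isLinear :=
  GRing.isLinear.Build R (Cspace K R) (c0 R) _ functionals_c0 functionals_linear.
Definition functionals_operator : {linear Cspace K R -> c0 R} :=
  HB.pack functionals_c0 functionals_isLinear.

Lemma functionals_bounded : bounded_operator functionals_operator.
Proof.
by exists M => f; apply: c0_norm_le => [|n]; [rewrite mulr_ge0|exact: nuM].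
Qed.

End functional_operator.

Lemma normr_sg_le1 (R : realType) (y : R) : `|Num.sg y| <= 1.
Proof. by rewrite normr_sg; case: (_ != _). Qed.

(** * Near biorthogonality of averages and blocks *)

Section block_functionals.
Context {R : realType} {K : compactHausdorffType}.
Context (T : {linear c0 R -> Cspace K R}) (M delta : R).
Context (x : nat -> K) (phi : nat -> nat) (psi : nat -> option nat).
Local Notation f n := (T (c0unit n)).
Local Notation sigma := (fun n => Num.sg (f n (x n))).
Local Notation s := (fun i => eval_state (x (phi i))).
Hypotheses (M0 : 0 < M) (TM : forall u, `|T u| <= M * `|u|).
Hypothesis x_large : forall n, delta <= `|f n (x n)|.
Hypothesis separated : forall i N,
  \sum_(n < N | `[< exists j, phi j = n >] && (n != phi i :> nat))
    `|f n (x (phi i))| <= delta / 4.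
Hypothesis psi_infty :
  forall l, exists N, forall n k, (N <= n)%N -> psi n = Some k -> (l <= k)%N.
Hypothesis psi_range : forall n, psi n -> exists i, phi i = n.

Local Notation B := (spread_c0 psi_infty (fun n => normr_sg_le1 (f n (x n)))).

(** The coordinate [phi i] gives the main term. The others are bounded by the norm of [u] and, as
    [psi_range] places them in the range of [phi], the gliding hump controls their sum. *)
Lemma spread_eval i u :
  `|T (B u) (x (phi i)) - spread_fun psi sigma u (phi i) * f (phi i) (x (phi i))|
    <= delta / 4 * `|u|.
Proof.
set m := phi i; set b := spread_fun psi sigma u.
have -> : T (B u) (x m) - b m * f m (x m) = T (B u - b m *: c0unit m) (x m).
  by rewrite linearB [T (_ *: _)]linearZZ.
apply: (operator_eval_le M0 TM) => N.
rewrite (le_trans (ler_norm_sum _ _ _))//.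
apply: le_trans (ler_wpM2r (normr_ge0 u) (separated i N)).
rewrite mulr_suml [leRHS]big_mkcond; apply: ler_sum => n _.
rewrite !c0E /= -/b -/m normrM; case: eqVneq => [->|nm].
  by rewrite mulr1 subrr normr0 mul0r; case: ifP => // _; rewrite mulr_ge0.
rewrite mulr0 subr0 andbT; case: asboolP => [_|nphi].
  by rewrite mulrC ler_wpM2l// (le_trans (c0_le_norm (B u) n))// spread_norm_le.
rewrite /b /spread_fun; case psin : (psi n) => [k|]; last by rewrite normr0 mul0r.
by case: nphi; apply: psi_range; rewrite psin.
Qed.

Lemma conv_block_off m n p u : (forall i, (m <= i < n)%N -> psi (phi i) = None) ->
  conv (block s m n) p -> `|p (T (B u))| <= delta / 4 * `|u|.
Proof.
move=> off mnp.
have eval_le q : block s m n q -> `|q (T (B u))| <= delta / 4 * `|u|.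
  move=> [i /off psii <-] /=; have := spread_eval i u.
  by rewrite /spread_fun psii mul0r subr0.
by rewrite ler_norml; apply/andP; split; [apply: conv_ge mnp|apply: conv_le mnp];
  move=> q /eval_le; rewrite ler_norml => /andP[].
Qed.

(** The signs turn each main term into a coefficient at least [delta] times [u k]. Such estimates
    survive convex combinations because one [k] serves the whole block. *)
Lemma conv_block_on m n k p : (forall i, (m <= i < n)%N -> psi (phi i) = Some k) ->
  conv (block s m n) p ->
  exists2 c, delta <= c & forall u, `|p (T (B u)) - c * u k| <= delta / 4 * `|u|.
Proof.
move=> on; elim=> [_ [i /on psii <-]|c q r r' c01 _ [a da qa] _ [b db rb] r'E].
  exists `|f (phi i) (x (phi i))| => // u /=; apply: le_trans (spread_eval i u).
  by rewrite /spread_fun psii mulrAC -normrEsg.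
exists (c * a + (1 - c) * b) => [|u].
  by move: c01 => /andP[? ?]; nra.
rewrite r'E; have := qa u; have := rb u; rewrite !ler_norml.
move: (_ * `|u|) (q _) (r _) (u k) => d Q S z /andP[? ?] /andP[? ?].
by move: c01 => /andP[? ?]; apply/andP; split; nra.
Qed.

End block_functionals.

Lemma embedding_units_large (R : realType) (K : compactHausdorffType)
    (T : {linear c0 R -> Cspace K R}) : isomorphic_embedding T ->
  exists2 delta, 0 < delta &
    exists x : nat -> K, forall n, delta <= `|T (c0unit n) (x n)|.
Proof.
move=> [_ _ [S [TK [N SN]]]].
(* If the image of a unit vector stayed below this [delta], the bound [N] of the inverse would give
   [1 <= 1 / 2]. *)
pose delta := (2 * (`|N| + 1))^-1.
have N1 : 0 < `|N| + 1 by rewrite ltr_wpDl.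
have d0 : 0 < delta by rewrite invr_gt0 mulr_gt0.
exists delta => //.
suff ex_x n : exists y, delta <= `|T (c0unit n) y|.
  by have [x xP] := choice ex_x; exists x.
apply: contrapT => /forallNP small.
have Tn : `|T (c0unit n)| <= delta.
  apply: supnorm_le; first exact: ltW.
  by move=> y; rewrite ltW// ltNge; apply/negP; exact: small.
have := SN (T (c0unit n)) (imageP _ I); rewrite TK => Nn.
have : 1 <= (`|N| + 1) * delta.
  apply: (le_trans (c0unit_norm_ge1 n)); apply: (le_trans Nn).
  apply: (le_trans (ler_wpM2r (normr_ge0 _) (ler_norm N))).
  by rewrite ler_pM// lerDl.
by rewrite /delta invfM mulrCA divff ?gt_eqF// mulr1; lra.
Qed.

(* Only the even blocks carry the new basis; the functionals are differences of
   the averages over an even block and over the next odd one. *)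
Lemma block_index (phi a : nat -> nat) :
  {homo phi : i j / (i < j)%N} -> {homo a : i j / (i < j)%N} ->
  exists psi : nat -> option nat,
  [/\ forall l, exists N, forall n k, (N <= n)%N -> psi n = Some k -> (l <= k)%N,
      forall n, psi n -> exists i, phi i = n,
      forall k i, (a k.*2 <= i < a k.*2.+1)%N -> psi (phi i) = Some k &
      forall k i, (a k.*2.+1 <= i < a k.*2.+2)%N -> psi (phi i) = None].
Proof.
move=> phi_mono a_mono.
have phi_le : {homo phi : i j / (i <= j)%N}.
  by move=> i j; rewrite leq_eqVlt => /predU1P[->//|/phi_mono/ltnW].
have phi_inj : injective phi.
  by move=> i j ij; case: (ltngtP i j) => // /phi_mono; rewrite ij ltnn.
have a_le : {homo a : i j / (i <= j)%N}.
  by move=> i j; rewrite leq_eqVlt => /predU1P[->//|/a_mono/ltnW].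
have a_uniq k l i : (a k <= i < a k.+1)%N -> (a l <= i < a l.+1)%N -> k = l.
  move=> /andP[ak ka] /andP[al la]; case: (ltngtP k l) => // /a_le h.
    by have := leq_ltn_trans al ka; rewrite ltnNge h.
  by have := leq_ltn_trans ak la; rewrite ltnNge h.
pose inblock n k := exists2 i, phi i = n & (a k.*2 <= i < a k.*2.+1)%N.
have ex_psi n : exists o : option nat,
    (forall k, o = Some k -> inblock n k) /\ (o = None -> forall k, ~ inblock n k).
  have [[k nk]|nk] := pselect (exists k, inblock n k).
    by exists (Some k); split=> // _ [<-].
  by exists None; split=> // _ k nk'; apply: nk; exists k.
have [psi psiP] := choice ex_psi; exists psi; split.
(* For [k < l] the block carrying [k] ends no later than [a l.*2]. *)
- move=> l; exists (phi (a l.*2)) => n k ln /(psiP n).1[i iphi /andP[_ ik]].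
  rewrite leqNgt; apply/negP => kl; move: ln; rewrite -iphi leqNgt => /negP; apply.
  by apply: phi_mono; apply: leq_trans ik _; apply: a_le; rewrite ltn_double.
- by move=> n; case psin : (psi n) => [k|//] _; have [i <- _] := (psiP n).1 _ psin; exists i.
- move=> k i ik; case psin : (psi _) => [l|].
    have [j /phi_inj -> jl] := (psiP _).1 _ psin.
    by have /double_inj -> := a_uniq _ _ _ jl ik.
  by have [] := (psiP _).2 psin k; exists i.
- move=> k i ik; case psin : (psi _) => [l|//].
  have [j /phi_inj jE jl] := (psiP _).1 _ psin; rewrite jE in jl.
  by have /(congr1 odd) := a_uniq _ _ _ jl ik; rewrite /= !odd_double.
Qed.

(** * The block basis and its projection *)

Theorem theorem8p4 (R : realType) (K : compactHausdorffType)
    (hK : class_MS R K) (T : {linear c0 R -> Cspace K R})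
    (hT : isomorphic_embedding T) :
  exists Y : set (Cspace K R),
    [/\ Y `<=` range T, closed_subspace Y,
        isomorphic_to (c0 R) Y & complemented Y].
Proof.
have [[M' TM'] _ _] := hT; pose M : R := `|M'| + 1.
have M0 : 0 < M by rewrite ltr_wpDl.
have TM u : `|T u| <= M * `|u|.
  by rewrite (le_trans (TM' u))// ler_wpM2r// (le_trans (ler_norm _))// lerDl.
have [delta d0 [x x_large]] := embedding_units_large hT.
(* The even and the odd average each err by a quarter of [delta]; division by a coefficient at least
   [delta] leaves the 1/2 that the Neumann series allows. *)
have d40 : 0 < delta / 4 by rewrite divr_gt0.
have [phi [phi_mono separated]] := separated_subsequence x (units_null M0 TM) d40.
have [t ts t_stable] := class_MS_stable_refinement (fun i => eval_state (x (phi i))) hK.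
have [tau [a [tau_ge a_mono t_conv]]] := finer_blocks ts.
have [psi [psi_infty psi_range psi_on psi_off]] := block_index phi_mono a_mono.
pose p k := t (tau k.*2); pose q k := t (tau k.*2.+1).
pose B := spread_c0 psi_infty (fun n => normr_sg_le1 (T (c0unit n) (x n))).
have ex_c k : exists c, delta <= c /\
    forall u, `|p k (T (B u)) - c * u k| <= delta / 4 * `|u|.
  have [c dc cP] := conv_block_on M0 TM x_large separated psi_infty psi_range
    (psi_on k) (t_conv _).
  by exists c.
have qP k u : `|q k (T (B u))| <= delta / 4 * `|u|.
  exact: (conv_block_off M0 TM separated psi_infty psi_range u (psi_off k) (t_conv _)).
have [c cP] := choice ex_c.
have c0_ k : 0 < c k by apply: lt_le_trans d0 (cP k).1.
have cV k : (c k)^-1 <= delta^-1.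
  by rewrite lef_pV2 ?posrE// (cP k).1.
(* Division by [c k] normalizes the value on the [k]-th block. Subtracting [q k] changes this value
   only slightly and makes the functionals weak*-null, since [t] is stable on every function. *)
pose nu k g := (c k)^-1 * (p k g - q k g).
have nuP k b f g : nu k (b *: f + g) = b * nu k f + nu k g.
  by rewrite /nu !stateP; ring.
have nuN k g : `|nu k g| <= delta^-1 * `|p k g - q k g|.
  by rewrite normrM ler_wpM2r// ger0_norm// invr_ge0 ltW.
have nu_null g : null_seq (fun k => nu k g).
  move=> e e0; have [m mP] := t_stable g (delta * e) (mulr_gt0 d0 e0).
  exists m => k mk; rewrite (le_trans (nuN _ _))// mulrC ler_pdivrMr// mulrC.
  have mp : (m <= tau k.*2)%N.
    by rewrite (leq_trans mk)// (leq_trans _ (tau_ge _))// -addnn leq_addr.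
  have mq : (m <= tau k.*2.+1)%N.
    by rewrite (leq_trans mk)// (leq_trans _ (tau_ge _))// -addnn leqW// leq_addr.
  by rewrite ler_norml lerNl opprB !mP.
have nuM k g : `|nu k g| <= delta^-1 * 2 * `|g|.
  rewrite (le_trans (nuN _ _))// -mulrA ler_wpM2l ?invr_ge0 ?(ltW d0)//.
  rewrite (le_trans (ler_normB _ _))// mulr_natl mulr2n.
  by rewrite lerD ?state_ler_norm.
have D0 : 0 <= delta^-1 * 2 by rewrite mulr_ge0// invr_ge0 ltW.
pose J : {linear c0 R -> Cspace K R} := T \o B.
pose S : {linear Cspace K R -> c0 R} := functionals_operator nuP nu_null.
have SJ u : `|S (J u) - u| <= `|u| / 2.
  apply: c0_norm_le => [|k]; first by rewrite divr_ge0.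
  have -> : (S (J u) - u) k = (c k)^-1 * (p k (J u) - c k * u k - q k (J u)).
    rewrite !c0E [X in X - _]/(nu k (J u)) /nu; field; exact: lt0r_neq0.
  rewrite normrM ger0_norm ?invr_ge0 ?(ltW (c0_ k))//.
  apply: le_trans (ler_wpM2r (normr_ge0 _) (cV k)) _.
  rewrite mulrC ler_pdivrMr// (le_trans (ler_normB _ _))//.
  have := (cP k).2 u; have := qP k u; rewrite -/(J u); lra.
exists (range J); have [] := @complemented_range R (Cspace K R) J S _ _ SJ.
- exists M => u; rewrite (le_trans (TM _))// ler_wpM2l ?(ltW M0)//; exact: spread_norm_le.
- exact: (functionals_bounded nuP nu_null D0 nuM).
by move=> Ycl Yc0 Ycomp; split=> // _ [u _ <-]; exists (B u).
Qed.
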